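(* Let $k\ge 1$ be an integer and let $\phi:[-2,2]\to\mathbb{R}$ be a smooth function. Then $$\frac12\langle \mathcal{N}\phi,\phi\rangle=\sum_{l=1}^{k}\frac{(-1)^{l-1}}{l}\,\|\partial^{(l-1)}\phi'\|^{2}_{\alpha^{\otimes l}}+\frac{(-1)^k}{k}\left\langle \mathcal{M}^{(k)}(\mathcal{M}^{(k)}+kI)^{-1}\partial^{(k-1)}\phi',\,\partial^{(k-1)}\phi'\right\rangle_{\alpha^{\otimes k}}.$$ Moreover, $\phi$ is a polynomial of degree at most $k$ if and only if $$\frac12\langle \mathcal{N}\phi,\phi\rangle=\sum_{l=1}^{k}\frac{(-1)^{l-1}}{l}\,\|\partial^{(l-1)}\phi'\|^{2}_{\alpha^{\otimes l}}.$$
   Context: On $[-2,2]$ let $\alpha(dx)=\frac{\sqrt{4-x^2}}{2\pi}dx$ (semicircular law) and $\beta(dx)=\frac{dx}{\pi\sqrt{4-x^2}}$ (arcsine law). $\langle\cdot,\cdot\rangle$ is the inner product of $L^2(\beta)$; $\langle\cdot,\cdot\rangle_{\alpha^{\otimes k}}$ and $\|\cdot\|_{\alpha^{\otimes k}}$ are the inner product and norm of $L^2(\alpha^{\otimes k})$ on $[-2,2]^k$. For a $C^2$ function $\phi$ on $[-2,2]$, $$(\mathcal{N}\phi)(x)=\int y\phi'(y)\beta(dy)+x\int\phi'(y)\beta(dy)-(4-x^2)\int\frac{\phi'(x)-\phi'(y)}{x-y}\beta(dy).$$ Let $\psi_n(x)=U_n(x/2)$, $n\ge0$, where $U_n(\cos\theta)=\frac{\sin((n+1)\theta)}{\sin\theta}$;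 $(\psi_n)_{n\ge 0}$ is an orthonormal basis of $L^2(\alpha)$. $\mathcal{M}$ is the (unbounded, self-adjoint, non-negative) operator on $L^2(\alpha)$ with $\mathcal{M}\psi_n=n\psi_n$; on $C^2$ functions it is given by $(\mathcal{M}\phi)(x)=2\,\mathrm{p.v.}\int\frac{\phi(x)-\phi(y)}{(x-y)^2}\alpha(dy)$. For $k\ge1$, $\mathcal{M}^{(k)}$ is the self-adjoint operator on $L^2(\alpha^{\otimes k})$ extending $\mathcal{M}^{(k)}(P_1\otimes\cdots\otimes P_k)=\sum_{i=1}^kP_1\otimes\cdots\otimes(\mathcal{M}P_i)\otimes\cdots\otimes P_k$ on polynomials, i.e. $\mathcal{M}^{(k)}(\psi_{a_1}\otimes\cdots\otimes\psi_{a_k})=(a_1+\cdots+a_k)\,\psi_{a_1}\otimes\cdots\otimes\psi_{a_k}$. The non-commutative derivative is $(\partial f)(x,y)=\frac{f(x)-f(y)}{x-y}$ (extended by $f'(x)$ on the diagonal); on polynomials, $\partial X^a=\sum_{p+q=a-1}X^p\otimes X^q$, with $P\otimes Q$ identified with $P(x)Q(y)$. Its higher versions are $\partial^{(0)}=I$, $\partial^{(1)}=\partial$, $\partial^{(k)}=(\partial\otimes I^{\otimes(k-1)})\partial^{(k-1)}$, i.e. $\partial$ is applied in the first variable; thus $\partial^{(k)}f$ is a smooth function of $k+1$ variables on $[-2,2]^{k+1}$ when $f$ is smooth on $[-2,2]$. *)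

(* Defs.v *)
From HB Require Import structures.
From mathcomp Require Import all_boot all_order all_algebra.
From mathcomp Require Import all_classical all_reals all_analysis.
From mathcomp Require Import measurable_realfun ring lra.

Set Implicit Arguments.
Unset Strict Implicit.
Unset Printing Implicit Defensive.
Import Order.TTheory GRing.Theory Num.Theory.
Import numFieldNormedType.Exports.
Local Open Scope classical_set_scope.
Local Open Scope ring_scope.

Section measure_with_density.
Context {R : realType}.
Local Notation mu := (@lebesgue_measure R).
Context (f : measurableTypeR R -> R).
Hypotheses (f_ge0 : forall x, 0 <= f x) (mf : measurable_fun setT f).

Definition with_density of (forall x, 0 <= f x) & measurable_fun setT f :
    set (measurableTypeR R) -> \bar R :=
  fun A => (\int[mu]_(x in A) (f x)%:E)%E.

Local Notation m := (with_density f_ge0 mf).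

Let m0 : m set0 = 0%E.
Proof. by rewrite /with_density integral_set0. Qed.

Let m_ge0 A : (0 <= m A)%E.
Proof. by apply: integral_ge0 => x _; rewrite lee_fin. Qed.

Let m_sigma_additive : semi_sigma_additive m.
Proof.
move=> F mF tF mUF; rewrite /with_density; apply: cvg_toP.
  apply: ereal_nondecreasing_is_cvgn => p q pq.
  apply: lee_sum_nneg_natr => // i _ _.
  by apply: integral_ge0 => x _; rewrite lee_fin.
rewrite ge0_integral_bigcup//=.
- by apply/measurable_EFinP; apply: (measurable_funS _ _ mf).
- by move=> x _; rewrite lee_fin.
Qed.

HB.instance Definition _ := isMeasure.Build _ _ _ m m0 m_ge0 m_sigma_additive.

End measure_with_density.

Section semicircle_arcsine.
Context {R : realType}.
Local Notation mu := (@lebesgue_measure R).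

Definition semicircle_pdf (x : measurableTypeR R) : R :=
  Num.sqrt (4 - x ^+ 2) / (2 * pi).

Definition arcsine_pdf (x : measurableTypeR R) : R :=
  (pi * Num.sqrt (4 - x ^+ 2))^-1.

Lemma semicircle_pdf_ge0 x : 0 <= semicircle_pdf x.
Proof. by rewrite divr_ge0 ?sqrtr_ge0// mulr_ge0 ?pi_ge0. Qed.

Lemma arcsine_pdf_ge0 x : 0 <= arcsine_pdf x.
Proof. by rewrite invr_ge0 mulr_ge0 ?pi_ge0 ?sqrtr_ge0. Qed.

Let measurable_fun_inv : measurable_fun setT (@GRing.inv R).
Proof.
rewrite -(setvU [set (0 : R)]); apply/measurable_funU => //.
  exact: measurableC.
split; last exact: measurable_fun_set1.
apply: open_continuous_measurable_fun.
  exact/closed_openC/closed_eq.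
by move=> x; rewrite inE /= => /eqP x0; exact: inv_continuous.
Qed.

Let continuous_sqrt4 : continuous (fun x : R => Num.sqrt (4 - x ^+ 2)).
Proof.
move=> x; apply: continuous_comp; last exact: sqrt_continuous.
by apply: cvgB; [exact: cvg_cst|exact: exprn_continuous].
Qed.

Lemma continuous_semicircle_pdf : continuous (semicircle_pdf : R -> R).
Proof. by move=> x; apply: cvgM; [exact: continuous_sqrt4|exact: cvg_cst]. Qed.

Lemma measurable_semicircle_pdf : measurable_fun setT semicircle_pdf.
Proof.
by apply: continuous_measurable_fun; exact: continuous_semicircle_pdf.
Qed.

Lemma measurable_arcsine_pdf : measurable_fun setT arcsine_pdf.
Proof.
apply: (measurableT_comp measurable_fun_inv).
apply: measurable_funM => //.
by apply: continuous_measurable_fun; exact: continuous_sqrt4.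
Qed.

Lemma integral_semicircle_pdf : (\int[mu]_x (semicircle_pdf x)%:E = 1)%E.
Proof.
transitivity (\int[mu]_(x in `[(-2)%R, 2%R]%classic) (semicircle_pdf x)%:E)%E.
  rewrite [RHS]integral_mkcond; apply: eq_integral => x _ /=.
  rewrite patchE; case: ifPn => // /negP xI.
  rewrite /semicircle_pdf ler0_sqrtr ?mul0r// leNgt; apply/negP => x4.
  by apply: xI; rewrite inE /= in_itv /=; apply/andP; split; nra.
have p0 : 0 < pi :> R by exact: pi_gt0.
have pn0 : pi != 0 :> R by rewrite gt_eqF.
pose c (t : R) : R := 2 * cos t.
have dc (t : R) : is_derive t 1 c (- (2 * sin t)).
  by rewrite /c; apply: is_derive_eq; rewrite /GRing.scale /=; ring.
have Dc : (derive1 c) = (fun t => - (2 * sin t)).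
  by apply/funext => t; rewrite derive1E; exact: derive_val.
have cDc : continuous (derive1 c).
  rewrite Dc => t; apply: cvgN; apply: cvgM; [exact: cvg_cst|].
  exact: continuous_sin.
have cc : continuous c.
  by move=> t; apply: cvgM; [exact: cvg_cst|exact: continuous_cos].
have -> : `[-2, 2]%classic = `[c pi, c 0]%classic :> set R.
  by rewrite /c cos0 cospi mulr1 mulrN1.
rewrite (@integration_by_substitution_decreasing _ c semicircle_pdf)//; last 6 first.
- exact: pi_ge0.
- move=> s t s0 t0 st; rewrite /c ltr_pM2l// ltr_cos//.
- by apply/cvg_ex; exists ((derive1 c) 0); apply: cvg_at_right_filter; exact: cDc.
- by apply/cvg_ex; exists ((derive1 c) pi); apply: cvg_at_left_filter; exact: cDc.
- split; first by move=> t _.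
    by apply: cvg_at_right_filter; exact: cc.
  by apply: cvg_at_left_filter; exact: cc.
- exact/continuous_subspaceT/continuous_semicircle_pdf.
pose g (t : R) : R := 2 / pi * sin t ^+ 2.
pose G (t : R) : R := (t - sin t * cos t) / pi.
have dG (t : R) : is_derive t 1 G (g t).
  rewrite /G /g; apply: is_derive_eq.
  rewrite /GRing.scale /=.
  rewrite !mulr0 add0r -[X in _ * (X - _)](cos2Dsin2 t).
  by rewrite [2 / _]mulrC -mulrA; congr (_ * _); ring.
transitivity (\int[mu]_(t in `[0%R, pi]%classic) (g t)%:E)%E.
  apply: eq_integral => t; rewrite inE /= in_itv /= => t0.
  congr EFin; rewrite /g Dc /c /semicircle_pdf fctE /= opprK.
  have -> : 4 - (2 * cos t) ^+ 2 = (2 * sin t) ^+ 2 :> R.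
    by rewrite !exprMn sin2cos2; ring.
  rewrite sqrtr_sqr ger0_norm ?mulr_ge0 ?sin_ge0_pi//.
  move: (pi : R) pn0 => p pn0; by field.
rewrite (@continuous_FTC2 _ g G)//; last 3 first.
- apply: continuous_subspaceT => t; apply: cvgM; first exact: cvg_cst.
  by apply: cvgM; exact: continuous_sin.
- have cG : continuous G.
    by move=> t; apply/differentiable_continuous/derivable1_diffP.
  split; first by move=> t _.
    by apply: cvg_at_right_filter; exact: cG.
  by apply: cvg_at_left_filter; exact: cG.
- by move=> t _; rewrite derive1E; exact: derive_val.
rewrite /G sin0 sinpi !mul0r !subr0 mul0r sube0.
by rewrite divff.
Qed.

End semicircle_arcsine.

Section semicircle_arcsine_measures.
Context (R : realType).

(* [Num.sqrt] vanishes on negative numbers and [0^-1 = 0], so both densities *)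
(* are zero outside of ]-2, 2[.                                              *)
Definition semicircle : set (measurableTypeR R) -> \bar R :=
  with_density (@semicircle_pdf_ge0 R) (@measurable_semicircle_pdf R).

Definition arcsine : set (measurableTypeR R) -> \bar R :=
  with_density (@arcsine_pdf_ge0 R) (@measurable_arcsine_pdf R).

HB.instance Definition _ := Measure.on semicircle.
HB.instance Definition _ := Measure.on arcsine.

Let semicircle_setT : semicircle setT = 1%E.
Proof. exact: integral_semicircle_pdf. Qed.

HB.instance Definition _ :=
  @Measure_isProbability.Build _ _ R semicircle semicircle_setT.

End semicircle_arcsine_measures.
Arguments semicircle R : clear implicits.
Arguments arcsine R : clear implicits.

Section tuple_probability.
Context {d} {T : measurableType d} {R : realType}.

Definition cons_pair n (p : T * n.-tuple T) : n.+1.-tuple T :=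
  [tuple of p.1 :: p.2].

Lemma measurable_cons_pair n : measurable_fun setT (@cons_pair n).
Proof. by apply: measurable_cons. Qed.

HB.instance Definition _ n :=
  isMeasurableFun.Build _ _ _ _ (@cons_pair n) (@measurable_cons_pair n).

Fixpoint tuple_probability (P : probability T R) (n : nat) :
    probability (n.-tuple T) R :=
  match n with
  | 0 => \d_([tuple] : 0.-tuple T)
  | m.+1 => distribution (P \x tuple_probability P m)%E (@cons_pair m)
  end.

End tuple_probability.

Section operators.
Context {R : realType}.
Local Notation T := (measurableTypeR R).
Implicit Types (f phi : R -> R) (k : nat).

Definition seg : set R := `[-2, 2].

Definition cube k : set (k.-tuple T) := [set t | forall i, seg (tnth t i)].

(* A function on [-2, 2] is represented by an arbitrary extension [f] to [R]: *)
(* derivatives and integrals below only involve the values of [f] on [seg].   *)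
Definition diff_quotient f (x y : R) : R := (f x - f y) / (x - y).

Definition seg_derive f (x : R) : R :=
  lim (diff_quotient f x y @[y --> within seg x^']).

(* At the endpoints the derivatives are one-sided. *)
Definition seg_smooth phi : Prop :=
  forall (n : nat) (x : R), seg x ->
    cvg (diff_quotient (iter n seg_derive phi) x y @[y --> within seg x^']).

Definition beta_dot f g : R := \int[arcsine R]_(x in seg) (f x * g x).

(* The junk value of [diff_quotient phi' x] at x does not matter, [arcsine]  *)
(* having no atom.                                                           *)
Definition Nop phi (x : R) : R :=
  let phi' := seg_derive phi in
  \int[arcsine R]_(y in seg) (y * phi' y)
  + x * \int[arcsine R]_(y in seg) phi' y
  - (4 - x ^+ 2) * \int[arcsine R]_(y in seg) diff_quotient phi' x y.

Definition nc_derive f (x y : R) : R :=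
  if x == y then seg_derive f x else diff_quotient f x y.

(* Functions of finitely many variables are encoded on [seq R]; [nc_derive1] *)
(* sends functions of [n] variables to functions of [n + 1] variables.       *)
Definition nc_derive1 (F : seq R -> R) (s : seq R) : R :=
  if s is x :: y :: s' then nc_derive (fun z => F (z :: s')) x y else 0.

Definition nc_deriven (m : nat) f : seq R -> R :=
  iter m nc_derive1 (fun s => f (head 0 s)).

Definition alphan k : probability (k.-tuple T) R :=
  tuple_probability (semicircle R) k.

Definition alpha_dot k (F G : k.-tuple T -> R) : R :=
  \int[alphan k]_(t in @cube k) (F t * G t).

Definition alpha_norm k (F : k.-tuple T -> R) : R := Num.sqrt (alpha_dot F F).

Definition L2alpha k (F : k.-tuple T -> R) : Prop :=
  (F \_ (@cube k)) \in Lfun (alphan k) 2%:E.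

Fixpoint chebyU (n : nat) : {poly R} :=
  match n with
  | 0 => 1
  | 1 => 2 *: 'X
  | (m.+1 as n').+1 => 2 *: 'X * chebyU n' - chebyU m
  end.

Lemma chebyU_cos (n : nat) (theta : R) :
  (chebyU n).[cos theta] * sin theta = sin (n.+1%:R * theta).
Proof.
suff: (chebyU n).[cos theta] * sin theta = sin (n.+1%:R * theta) /\
   (chebyU n.+1).[cos theta] * sin theta = sin (n.+2%:R * theta) by case.
elim: n => [|n [IH0 IH1]].
  rewrite /= !hornerE; split; first by rewrite ?mul1r.
  by rewrite [in RHS]mulr_natl sin_mulr2n; ring.
split=> //; have -> : chebyU n.+2 = 2 *: 'X * chebyU n.+1 - chebyU n by [].
rewrite hornerD hornerN hornerM hornerZ hornerX mulrBl IH0.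
rewrite -[_ * sin theta]mulrA IH1.
have -> : n.+3%:R * theta = n.+2%:R * theta + theta by rewrite -addn1 natrD; ring.
have -> : n.+1%:R * theta = n.+2%:R * theta - theta.
  by rewrite -[n.+2]addn1 natrD; ring.
by rewrite sinB sinD; ring.
Qed.

Definition psi (n : nat) (x : R) : R := (chebyU n).[x / 2].

Definition psi_tensor k (a : k.-tuple nat) (t : k.-tuple T) : R :=
  \prod_(i < k) psi (tnth a i) (tnth t i).

(* [F] is in the domain of M^(k) and [G] represents M^(k) F: as the          *)
(* [psi_tensor a] form an orthonormal basis of L^2, the self-adjoint operator *)
(* with M^(k) psi_a = |a| psi_a multiplies the coordinate a by                *)
(* |a| = a_1 + ... + a_k, its domain being the set of F for which the result  *)
(* is again in L^2.                                                           *)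
Definition M_graph k (F G : k.-tuple T -> R) : Prop :=
  [/\ L2alpha F, L2alpha G &
      forall a : k.-tuple nat,
        alpha_dot G (psi_tensor a) =
        (\sum_(i < k) tnth a i)%N%:R * alpha_dot F (psi_tensor a)].

Definition Mop k (F : k.-tuple T -> R) : k.-tuple T -> R :=
  xget (fun=> 0) [set G | M_graph F G].

(* (M^(k) + c I)^-1 F: some U in the domain with M^(k) U + c U = F a.e. *)
Definition Mresolvent k (c : R) (F : k.-tuple T -> R) : k.-tuple T -> R :=
  xget (fun=> 0) [set U | exists2 V, M_graph U V &
    {ae alphan k, forall t, cube t -> V t + c * U t = F t}].

Definition seg_poly (n : nat) phi : Prop :=
  exists2 p : {poly R}, (size p <= n.+1)%N & forall x, seg x -> phi x = p.[x].

End operators.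

(* Main.v *)
(* With [t_n(2 cos s) = 2 cos (n s)], a smooth [phi] has an expansion          *)
(* [phi = A_0 + sum_(n >= 1) A_n t_n] with rapidly decreasing coefficients, so *)
(* that [phi' = sum_m b_m psi_m] with [b_m = (m + 1) A_(m + 1)].  Then:        *)
(* - [N t_n = n t_n], hence [<N phi, phi> / 2 = sum_m b_m^2 / (m + 1)];        *)
(* - [partial^(l-1) psi_m] is the sum of the [psi_a] over the multi-indices    *)
(*   [a] of length [l] and weight [m - l + 1], of which there are 'C(m, l-1),  *)
(*   hence [||partial^(l-1) phi'||^2 = sum_m 'C(m, l-1) b_m^2];                *)
(* - [M^(k) (M^(k) + k)^-1] multiplies such a [psi_a] of length [k] by         *)
(*   [(m - k + 1) / (m + 1)].                                                  *)
(* The identity thus reduces, for each [m], to                                 *)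
(*   [sum_(1 <= l <= k) (-1)^(l-1) 'C(m+1, l) + (-1)^k 'C(m, k) = 1],          *)
(* and the last term vanishes iff [b_m = 0] for all [m >= k].  All series are  *)
(* normally convergent, so only term by term computations are needed; in       *)
(* particular the completeness of the family [psi_a] plays no role.            *)
(* The pointwise expansion of [f] at [x0] comes from [f - f(x0) = (x - x0) g]: *)
(* the partial sums telescope (Christoffel-Darboux) to a remainder controlled  *)
(* by the coefficients of the continuous function [g], which tend to 0.        *)

Require Import Defs.
From mathcomp Require Import all_boot all_order all_algebra.
From mathcomp Require Import all_classical all_reals all_analysis.
From mathcomp Require Import measurable_realfun zify ring lra.
Import Order.TTheory GRing.Theory Num.Theory.
Import numFieldNormedType.Exports.
Set Implicit Arguments.
Unset Strict Implicit.
Unset Printing Implicit Defensive.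
Local Open Scope classical_set_scope.
Local Open Scope ring_scope.

(** * Chebyshev polynomials and their divided differences *)

Section chebyshev.
Context {R : realType}.
Implicit Types (x y : R) (s : seq R) (n m k : nat).

(** Chebyshev polynomials diagonalise every quantity of the theorem. Write [phi'] as the sum of the
    [b_j psi_j] with [b_j = psib phi j]. Then [partial^(l-1) psi_j] is the value of [csum] of degree
    [j - l + 1] in [l] variables ([csum_divdiff], [nc_deriven_series]). Contributions of distinct
    [j] are orthogonal, so each quantity is a series in [b_j ^ 2]. The weight is [1 / (j + 1)] for
    half of the form of N ([beta_dot_Nop]), ['C(j, l - 1)] for the squared norms
    ([alpha_norm_series]), and [(j - k + 1) / (j + 1) * 'C(j, k - 1)] for the resolvent term
    ([alpha_dot_Mop_Mresolvent]). For fixed [j] the identity is the closed form of a truncated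
    alternating sum of binomial coefficients ([alternating_binomial]).

    The weight of the resolvent term is nonnegative, and positive exactly for [j >= k]. The term
    therefore vanishes iff [b_j = 0] for all [j >= k], which means that [phi] is a polynomial of
    degree at most [k] ([seg_polyP]).

    The analysis rests on [psi_expansion] (pointwise convergence) and [psib_rapid] (decay faster
    than any power, by repeated integration by parts). As [csum] grows only polynomially in its
    degree ([csum_bound]), limits and integrals may be taken term by term ([series_cvg_filter],
    [Rintegral_series]). [Mop] and [Mresolvent] choose some representative; pairing it with [csum]
    gives a number that does not depend on the choice. *)

Lemma two_step_ind (P : nat -> Prop) :
  P 0%N -> P 1%N -> (forall n, P n -> P n.+1 -> P n.+2) -> forall n, P n.
Proof.
move=> P0 P1 PS n; suff: P n /\ P n.+1 by case.
by elim: n => // n [Pn Pn1]; split=> //; exact: PS.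
Qed.

Lemma seg_itv x : seg x <-> -2 <= x <= 2.
Proof. by rewrite /seg /= in_itv. Qed.

(* [tcheb n (2 cos t) = 2 cos (n t)]; in particular [tcheb 0] is 2, not 1. *)
Fixpoint tcheb n x : R :=
  match n with
  | 0 => 2
  | 1 => x
  | (m.+1 as n').+1 => x * tcheb n' x - tcheb m x
  end.

Lemma tcheb0 x : tcheb 0 x = 2.
Proof. by []. Qed.

Lemma tcheb1 x : tcheb 1 x = x.
Proof. by []. Qed.

Lemma tchebSS n x : tcheb n.+2 x = x * tcheb n.+1 x - tcheb n x.
Proof. by []. Qed.

Lemma psi0 x : psi 0 x = 1.
Proof. by rewrite /psi /= hornerE. Qed.

Lemma psi1 x : psi 1 x = x.
Proof. by rewrite /psi /= hornerZ hornerX mulrC divfK. Qed.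

Lemma psiSS n x : psi n.+2 x = x * psi n.+1 x - psi n x.
Proof.
rewrite /psi; have -> : chebyU n.+2 = 2 *: 'X * chebyU n.+1 - chebyU n :> {poly R} by [].
by rewrite hornerD hornerN hornerM hornerZ hornerX mulrCA mulfV// mulr1.
Qed.

Lemma tcheb_psi n x : tcheb n.+2 x = psi n.+2 x - psi n x.
Proof.
elim/two_step_ind: n => [||n IH0 IH1].
- by rewrite psiSS !psi0 psi1 /=; ring.
- by rewrite !psiSS !psi0 psi1 /=; ring.
- by rewrite tchebSS IH0 IH1 !psiSS; ring.
Qed.

Lemma tcheb_cos n (t : R) : tcheb n (2 * cos t) = 2 * cos (n%:R * t).
Proof.
elim/two_step_ind: n => [||n IH0 IH1].
- by rewrite mul0r cos0 mulr1.
- by rewrite mul1r.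
- rewrite tchebSS IH0 IH1.
  have -> : n.+2%:R * t = n.+1%:R * t + t by rewrite -[n.+2]addn1 natrD; ring.
  have -> : n%:R * t = n.+1%:R * t - t by rewrite -[n.+1]addn1 natrD; ring.
  by rewrite [in LHS]cosB [in RHS]cosD; ring.
Qed.

Lemma psi_cos n (t : R) : psi n (2 * cos t) * sin t = sin (n.+1%:R * t).
Proof. by rewrite -chebyU_cos /psi mulrAC mulfV// mul1r. Qed.

Lemma seg_cosP x : seg x -> exists2 t, t \in `[0, pi] & x = 2 * cos t.
Proof.
move=> /seg_itv/andP[x1 x2]; exists (acos (x / 2)).
  by rewrite in_itv /= acos_ge0 ?acos_lepi //; apply/andP; split; lra.
by rewrite acosK; [lra|rewrite in_itv /=; apply/andP; split; lra].
Qed.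

Lemma seg_cos (t : R) : seg (2 * cos t).
Proof.
by apply/seg_itv/andP; split; have := cos_le1 t; have := cos_geN1 t; lra.
Qed.

Lemma tcheb_bound n x : seg x -> `|tcheb n x| <= 2.
Proof.
move=> /seg_cosP[t _ ->]; rewrite tcheb_cos normrM ger0_norm//.
by rewrite -[leRHS]mulr1 ler_pM2l// ler_norml cos_le1 cos_geN1.
Qed.

(** Each step [psi n.+2 = tcheb n.+2 + psi n] adds at most 2. Unlike the quotient of sines, this
    argument also covers the endpoints. *)
Lemma psi_bound n x : seg x -> `|psi n x| <= n.+1%:R.
Proof.
move=> sx; elim/two_step_ind: n => [||n IH0 IH1].
- by rewrite psi0 normr1.
- by rewrite psi1; move/seg_itv : sx; rewrite ler_norml.
- have -> : psi n.+2 x = tcheb n.+2 x + psi n x by rewrite tcheb_psi; ring.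
  apply: (le_trans (ler_normD _ _)).
  have := tcheb_bound n.+2 sx; rewrite -(addn2 n.+1) natrD; lra.
Qed.

(** This is the product-to-sum formula for cosines, with the larger index written [n + m]. The
    recurrence proves it for every real [x]. *)
Lemma tchebM n m x :
  tcheb (n + m) x * tcheb n x = tcheb (n + m + n) x + tcheb m x.
Proof.
elim/two_step_ind: n m => [m|m|n IH0 IH1 m].
- by rewrite /= !add0n addn0; ring.
- by rewrite add1n addn1 /= ; ring.
- have := IH1 m.+1; have := IH0 m.+2; rewrite tchebSS.
  have -> : (n.+2 + m + n.+2 = (n + m + n).+4)%N by lia.
  have -> : (n + m.+2 + n = (n + m + n).+2)%N by lia.
  have -> : (n.+1 + m.+1 + n.+1 = (n + m + n).+3)%N by lia.
  have -> : (n + m.+2 = n.+2 + m)%N by lia.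
  have -> : (n.+1 + m.+1 = n.+2 + m)%N by lia.
  rewrite mulrBr mulrCA => -> ->.
  by rewrite [tcheb (_.+4) _]tchebSS ?[tcheb m.+2 _]tchebSS; ring.
Qed.

(** At [x = 2 cos t] this is [4 sin A sin B = 2 cos (A - B) - 2 cos (A + B)], since
    [4 - x ^ 2 = 4 (sin t) ^ 2]. It carries orthogonality of the [psi] over to that of the
    [tcheb]. *)
Lemma psiM n m x : (4 - x ^+ 2) * (psi (n + m) x * psi n x) =
  tcheb m x - tcheb (n + m + n).+2 x.
Proof.
elim/two_step_ind: n m => [m|m|n IH0 IH1 m].
- rewrite psi0 add0n addn0 mulr1.
  elim/two_step_ind: m => [||m Hm Hm1].
  + by rewrite psi0 /=; ring.
  + by rewrite psi1 /=; ring.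
  + rewrite [tcheb m.+4 _]tchebSS [tcheb m.+2 _]tchebSS psiSS mulrBr mulrCA Hm1 Hm.
    by rewrite [tcheb m.+3 _]tchebSS [tcheb m.+2 _]tchebSS; ring.
- rewrite psi1 add1n addn1.
  elim/two_step_ind: m => [||m Hm Hm1].
  + by rewrite psi1 /=; ring.
  + by rewrite psiSS psi1 psi0 /=; ring.
  + have -> : (4 - x ^+ 2) * (psi m.+3 x * x) =
      x * ((4 - x ^+ 2) * (psi m.+2 x * x)) - (4 - x ^+ 2) * (psi m.+1 x * x).
      by rewrite psiSS; ring.
    rewrite Hm Hm1.
    rewrite [tcheb m.+2.+4 _]tchebSS [tcheb m.+2 _]tchebSS; ring.
- have := IH1 m.+1; have := IH0 m.+2; rewrite [psi n.+2 _]psiSS.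
  have -> : (n.+2 + m + n.+2 = (n + m + n).+4)%N by lia.
  have -> : (n + m.+2 + n = (n + m + n).+2)%N by lia.
  have -> : (n.+1 + m.+1 + n.+1 = (n + m + n).+3)%N by lia.
  have -> : (n + m.+2 = n.+2 + m)%N by lia.
  have -> : (n.+1 + m.+1 = n.+2 + m)%N by lia.
  move=> E0 E1; rewrite mulrBr mulrBr E0.
  rewrite [X in X - _](_ : _ = x * ((4 - x ^+ 2) * (psi (n.+2 + m) x * psi n.+1 x))); last by ring.
  rewrite E1.
  by rewrite [tcheb (_.+4.+2) _]tchebSS [tcheb m.+2 _]tchebSS; ring.
Qed.

(* [csum n s] is the sum of [psi_a s] over the multi-indices [a] of total      *)
(* degree [n].                                                                *)
Fixpoint csum n s : R :=
  if s is x :: s' then \sum_(j < n.+1) psi j x * csum (n - j) s' else (n == 0)%:R.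

Lemma csum_cons n x s :
  csum n (x :: s) = \sum_(j < n.+1) psi j x * csum (n - j) s.
Proof. by case: n. Qed.

Lemma csum_nil n : csum n [::] = (n == 0)%:R.
Proof. by case: n. Qed.

#[local] Arguments csum : simpl never.

Lemma csum0 s : csum 0 s = 1.
Proof. by elim: s => [|x s IH]; rewrite ?csum_nil// csum_cons; rewrite big_ord1 IH psi0 mulr1. Qed.

Lemma csum1 n x : csum n [:: x] = psi n x.
Proof.
rewrite csum_cons (bigD1 ord_max)//= subnn mulr1 big1 ?addr0// => i.
rewrite -val_eqE csum_nil /= => ni; have := ltn_ord i; rewrite ltnS leq_eqVlt (negbTE ni)/=.
by move=> ltin; rewrite subn_eq0 leqNgt ltin mulr0.
Qed.

Lemma csum_consS x s : csum 1 (x :: s) = x + csum 1 s.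
Proof.
by rewrite csum_cons big_ord_recl big_ord1 /= csum0 psi0 psi1 !mul1r mulr1 addrC.
Qed.

(* The generating function of [psi] is [1 / (1 - x t + t ^ 2)]. *)
Lemma csum_consSS n x s : csum n.+2 (x :: s) =
  x * csum n.+1 (x :: s) - csum n (x :: s) + csum n.+2 s.
Proof.
rewrite !csum_cons [LHS]big_ord_recl /= psi0 mul1r subn0 [LHS]addrC; congr +%R.
rewrite [LHS]big_ord_recl /= [in RHS]big_ord_recl /= /bump /= !add1n psi0 psi1.
rewrite mulrDr mul1r subn0 subSS subn0 -addrA; congr +%R.
rewrite mulr_sumr -sumrB; apply: eq_bigr => i _.
by rewrite /bump /= !add1n !subSS psiSS; ring.
Qed.

(** In terms of generating functions, [1 / (1 - x t + t^2) - 1 / (1 - y t + t^2)] is [(x - y) t]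
    times the product of the two fractions. Hence a divided difference in the first variable lowers
    the degree by one and adds a variable. *)
Lemma csum_divdiff n x y s :
  csum n.+1 (x :: s) - csum n.+1 (y :: s) = (x - y) * csum n (x :: y :: s).
Proof.
elim/two_step_ind: n => [||n IH0 IH1].
- by rewrite !csum_consS csum0; ring.
- rewrite 2!csum_consSS csum_consS !csum_consS !csum0; ring.
- have -> : csum n.+3 (x :: s) - csum n.+3 (y :: s) =
    x * (csum n.+2 (x :: s) - csum n.+2 (y :: s)) + (x - y) * csum n.+2 (y :: s)
    - (csum n.+1 (x :: s) - csum n.+1 (y :: s)).
    by rewrite [csum n.+3 (x :: _)]csum_consSS [csum n.+3 (y :: _)]csum_consSS; ring.
  by rewrite IH0 IH1 [csum n.+2 (x :: y :: s)]csum_consSS; ring.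
Qed.

(** Each variable costs two powers of [n + 1]: one for the number of terms of the sum over [j], one
    for [psi_bound]. Polynomial growth is all that is needed against rapidly decreasing
    coefficients. *)
Lemma csum_bound n s : all (fun x => `[< seg x >]) s ->
  `|csum n s| <= n.+1%:R ^+ (2 * size s).
Proof.
elim: s n => [n _|x s IH n /andP[/asboolP sx ss]].
  by rewrite csum_nil /= muln0 expr0; case: eqP; rewrite ?normr0 ?normr1.
rewrite csum_cons /= mulnS addnC exprD.
have -> : n.+1%:R ^+ (2 * size s) * n.+1%:R ^+ 2 =
    \sum_(j < n.+1) (n.+1%:R * n.+1%:R ^+ (2 * size s)) :> R.
  by rewrite big_const_ord iter_addr addr0 -mulr_natr; ring.
apply: (le_trans (ler_norm_sum _ _ _)); apply: ler_sum => j _.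
rewrite normrM ler_pM//.
  by apply: le_trans (psi_bound _ sx) _; rewrite ler_nat.
apply: le_trans (IH _ ss) _; apply: lerXn2r; rewrite ?nnegrE// ler_nat.
by rewrite ltnS leq_subr.
Qed.

End chebyshev.
#[global] Arguments csum : simpl never.
#[global] Arguments tcheb : simpl never.

(** * Series and non-commutative derivatives *)

Section series_toolkit.
Context {R : realType}.
Implicit Types (u v M b : R ^nat).

Lemma cvg_sum_fun (T : Type) (F : set_system T) {FF : Filter F} (n : nat)
    (g : nat -> T -> R) (l : R ^nat) :
  (forall i, g i y @[y --> F] --> l i) ->
  \sum_(i < n) g i y @[y --> F] --> \sum_(i < n) l i.
Proof.
move=> gl; elim: n => [|n IH].
  by rewrite big_ord0; under eq_fun do rewrite big_ord0; exact: cvg_cst.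
rewrite big_ord_recr /=; under eq_fun do rewrite big_ord_recr /=.
exact: cvgD.
Qed.

Lemma series_remainder_le u M (l : R) (n : nat) :
  (forall n, `|u n| <= M n) -> cvgn (series M) -> series u @ \oo --> l ->
  `|l - series u n| <= limn (series M) - series M n.
Proof.
move=> uM cM ul.
have cu : series u m - series u n @[m --> \oo] --> l - series u n.
  by apply: cvgB => //; exact: cvg_cst.
have cM' : series M m - series M n @[m --> \oo] --> limn (series M) - series M n.
  by apply: cvgB => //; exact: cvg_cst.
have cnu : `|series u m - series u n| @[m --> \oo] --> `|l - series u n|.
  exact: cvg_norm.
rewrite -(cvg_lim _ cnu)// -(cvg_lim _ cM')//.
apply: ler_lim.
- by apply/cvg_ex; eexists; exact: cnu.
- by apply/cvg_ex; eexists; exact: cM'.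
exists n => // m /= nm; rewrite !sub_series nm.
by apply: (le_trans (ler_norm_sum _ _ _)); apply: ler_sum.
Qed.

Lemma series_abs_cvg u M :
  (forall n, `|u n| <= M n) -> cvgn (series M) -> cvgn (series u).
Proof.
move=> uM cM; apply: normed_cvg; apply: (series_le_cvg _ _ _ cM) => n.
- exact: normr_ge0.
- exact: le_trans (uM n).
- exact: uM.
Qed.

(* Tannery's theorem along a filter. *)
Lemma series_cvg_filter (T : Type) (F : set_system T) {FF : ProperFilter F}
    (g : nat -> T -> R) (G : T -> R) (l M : R ^nat) (L : R) :
  cvgn (series M) ->
  (forall n, \forall y \near F, `|g n y| <= M n) ->
  (\forall y \near F, (forall n, `|g n y| <= M n) /\
     series (fun n => g n y) @ \oo --> G y) ->
  (forall n, g n y @[y --> F] --> l n) ->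
  series l @ \oo --> L -> G y @[y --> F] --> L.
Proof.
move=> cM gM' gM gl lL.
have lM n : `|l n| <= M n.
  have cn : `|g n y| @[y --> F] --> `|l n| by exact: cvg_norm.
  rewrite -(cvg_lim _ cn)//; apply: limr_le; first by apply/cvg_ex; eexists; exact: cn.
  exact: gM'.
apply/cvgrPdist_le => e e0.
have [N _ HN] : \forall n \near \oo, `|limn (series M) - series M n| <= e / 3.
  by move/cvgrPdist_le : cM; apply; lra.
have MN : limn (series M) - series M N <= e / 3.
  by apply: le_trans (ler_norm _) (HN N _) => /=.
have cN : series (fun n => g n y) N @[y --> F] --> series l N.
  by rewrite seriesEord; under eq_fun do rewrite seriesEord; exact: cvg_sum_fun.
move/cvgrPdist_le : cN => /(_ (e / 3)) cN.
have : \forall y \near F, `|series l N - series (fun n => g n y) N| <= e / 3.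
  by apply: cN; lra.
apply: filterS2 gM => y [gyM gyG] h.
have h1 := series_remainder_le N lM cM lL.
have h2 := series_remainder_le N gyM cM gyG.
have -> : L - G y = (L - series l N) + (series l N - series (fun n => g n y) N)
   - (G y - series (fun n => g n y) N) by ring.
apply: (le_trans (ler_normB _ _)); apply: (@le_trans _ _ (e/3 + e/3 + e/3)); last by lra.
apply: lerD; last exact: le_trans h2 MN.
apply: (le_trans (ler_normD _ _)); apply: lerD => //; exact: le_trans h1 MN.
Qed.

Definition rapid b := forall r : nat, exists C : R, forall n, `|b n| * n.+1%:R ^+ r <= C.

Lemma cvg_series_telescope_harmonic :
  cvgn (series (fun n => (n.+1%:R * n.+2%:R)^-1 : R)).
Proof.
have -> : (fun n => (n.+1%:R * n.+2%:R)^-1 : R) = telescope (fun n => - harmonic n).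
  apply/funext => n; rewrite /telescope /harmonic /=.
  have n1 : n.+1%:R != 0 :> R by rewrite pnatr_eq0.
  have n2 : n.+2%:R != 0 :> R by rewrite pnatr_eq0.
  move: n2; rewrite -(natr1 n.+1) => n2.
  have H (a : R) : a != 0 -> a + 1 != 0 -> (a * (a + 1))^-1 = - (a + 1)^-1 - - a^-1.
    by move=> a0 a1; field; rewrite ?a0 ?a1.
  exact: H.
have -> : series (telescope (fun n => - harmonic n)) = (fun n => - harmonic n - - harmonic 0) :> R ^nat.
  apply/funext => n; rewrite /series /telescope /=.
  by rewrite telescope_sumr.
apply/cvg_ex; exists (- 0 - - harmonic 0); apply: cvgB; last exact: cvg_cst.
by apply: cvgN; exact: cvg_harmonic.
Qed.

Lemma rapid_summable b r : rapid b -> cvgn (series (fun n => `|b n| * n.+1%:R ^+ r)).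
Proof.
move=> /(_ r.+2)[C bC].
have C0 : 0 <= C by apply: le_trans (bC 0%N); rewrite mulr_ge0.
(* Two spare powers of [n + 1] allow a comparison with the telescoping series; the factor 2 comes
   from [n + 2 <= 2 (n + 1)]. *)
pose v : R ^nat := (2 * C) *: (fun n => (n.+1%:R * n.+2%:R)^-1 : R).
have cv : cvgn (series v) by apply: is_cvg_seriesZ; exact: cvg_series_telescope_harmonic.
apply: (series_le_cvg _ _ _ cv) => n.
- by rewrite mulr_ge0// exprn_ge0.
- by rewrite /v /= mulr_ge0// ?mulr_ge0// invr_ge0 mulr_ge0.
rewrite /v /= -[leRHS]/(2 * C * _) ler_pdivlMr ?mulr_gt0//.
have := bC n; rewrite -addn2 exprD mulrA.
set A := _ * _ ^+ r; rewrite expr2 => h.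
have A0 : 0 <= A by rewrite mulr_ge0// exprn_ge0.
have -> : n.+2%:R = n.+1%:R + 1 :> R by rewrite -natr1.
have : 1 <= n.+1%:R :> R by rewrite ler1n.
set x := n.+1%:R in h *; move=> x1.
nra.
Qed.

Lemma rapid_le b b' (C : R) r : (forall n, `|b' n| <= C * (`|b n| * n.+1%:R ^+ r)) -> rapid b -> rapid b'.
Proof.
move=> bb rb s; have [D bD] := rb (r + s)%N.
have D0 : 0 <= D by apply: le_trans (bD 0%N); rewrite mulr_ge0// exprn_ge0.
exists (`|C| * D) => n.
apply: (@le_trans _ _ (`|C| * (`|b n| * n.+1%:R ^+ r) * n.+1%:R ^+ s)).
  apply: ler_wpM2r; first exact: exprn_ge0.
  apply: le_trans (bb n) _; apply: ler_wpM2r; first by rewrite mulr_ge0// exprn_ge0.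
  exact: ler_norm.
by rewrite -!mulrA -exprD ler_wpM2l.
Qed.

Lemma rapidS b : rapid b -> rapid (fun n => b n.+1).
Proof.
move=> rb r; have [D bD] := rb r; exists D => n.
apply: le_trans (bD n.+1); apply: ler_wpM2l => //.
by apply: lerXn2r; rewrite ?nnegrE// ler_nat.
Qed.

Lemma rapid_shift b m : rapid b -> rapid (fun n => b (n + m)%N).
Proof.
elim: m => [|m IH] rb.
  by have -> : (fun n => b (n + 0)%N) = b by apply/funext => n; rewrite addn0.
have -> : (fun n => b (n + m.+1)%N) = (fun n => b (n.+1 + m)%N).
  by apply/funext => n; rewrite addSnnS.
exact: (@rapidS (fun n => b (n + m)%N)) (IH rb).
Qed.

Lemma rapid_cvg0 b r : rapid b -> b n * n.+1%:R ^+ r @[n --> \oo] --> 0.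
Proof.
move=> /(@rapid_summable _ r)/cvg_series_cvg_0 h; apply/norm_cvg0P.
by under eq_fun do rewrite normrM normrX normr_nat.
Qed.

End series_toolkit.

(** * Term-by-term non-commutative derivatives of Chebyshev series *)

Section nc_derive_series.
Context {R : realType}.
Implicit Types (x y : R) (s : seq R) (f : R -> R) (b : R ^nat).

Lemma seg_limit_point x : seg x -> ProperFilter (within seg x^').
Proof.
move=> /seg_itv/andP[x1 x2]; apply: Build_ProperFilter_ex.
move=> P; rewrite /within /= /dnbhs /within /= => /nbhs_ballP[e /= e0 eP].
(* A step of length at most 1 towards the centre of the segment cannot leave it, so every point of
   [seg], endpoints included, is a limit point. *)
pose d := Num.min (e / 2) 1.
have d0 : 0 < d by rewrite lt_min ltr01 andbT; lra.
have de : d < e by rewrite gt_min; apply/orP; left; lra.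
have d1 : d <= 1 by rewrite ge_min lexx orbT.
have [x0|x0] := leP x 0.
  exists (x + d); apply: eP.
  - by rewrite /ball /= opprD addNKr normrN gtr0_norm.
  - by apply/negP => /eqP; lra.
  - by apply/seg_itv/andP; split; lra.
exists (x - d); apply: eP.
- by rewrite /ball /= opprB addrC subrK gtr0_norm.
- by apply/negP => /eqP; lra.
- by apply/seg_itv/andP; split; lra.
Qed.

Lemma near_within_seg x : \forall y \near within seg x^', seg y /\ y != x.
Proof. by rewrite near_withinE; near=> y => sy; split=> //; near: y; exact: nbhs_dnbhs_neq. Unshelve. all: by end_near. Qed.

(** Off the diagonal this is the linearity of difference quotients. On the diagonal [seg_derive] is
    a limit of such quotients, and the uniform bound [M] lets Tannery's theorem pass to the limit
    inside the sum. *)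
Lemma nc_derive_series f (g : nat -> R -> R) (h : nat -> R -> R) (M : R ^nat) x y :
  seg x -> seg y ->
  (forall z, seg z -> series (fun n => g n z) @ \oo --> f z) ->
  (forall n z, g n x - g n z = (x - z) * h n z) ->
  (forall n, continuous (h n)) ->
  cvgn (series M) -> (forall n z, seg z -> `|h n z| <= M n) ->
  exists2 D, series (fun n => h n y) @ \oo --> D & nc_derive f x y = D.
Proof.
move=> sx sy gf gh ch cM hM.
have hdq z : seg z -> x != z -> series (fun n => h n z) @ \oo --> diff_quotient f x z.
  move=> sz xz; rewrite /diff_quotient.
  have xz0 : x - z != 0 by rewrite subr_eq0.
  have -> : series (fun n => h n z) =
     (fun N => (series (fun n => g n x) N - series (fun n => g n z) N) / (x - z)).
    apply/funext => N; rewrite /series /= -sumrB mulr_suml; apply: eq_bigr => i _.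
    by rewrite gh mulrC mulKf.
  by apply: cvgM; [apply: cvgB; exact: gf|exact: cvg_cst].
rewrite /nc_derive; case: eqVneq => [<-{y sy}|xy]; last first.
  by exists (diff_quotient f x y) => //; exact: hdq.
have chx : cvgn (series (fun n => h n x)).
  by apply: series_abs_cvg cM => n; exact: hM.
exists (limn (series (fun n => h n x))) => //.
have PF := seg_limit_point sx.
rewrite /seg_derive; apply/cvg_lim => //.
apply: (@series_cvg_filter _ _ _ PF h _ (fun n => h n x) M) => //.
- move=> n; near=> z; apply: hM.
  by have [] : seg z /\ z != x by near: z; exact: near_within_seg.
- near=> z.
  have [sz zx] : seg z /\ z != x by near: z; exact: near_within_seg.
  by split; [move=> n; exact: hM|apply: hdq; rewrite // eq_sym].
- move=> n; apply: cvg_within_filter; apply: cvg_within_filter; exact: ch.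
Unshelve. all: by end_near. Qed.

Lemma continuous_psi n : continuous (psi n : R -> R).
Proof.
elim/two_step_ind: n => [||n IH0 IH1] x.
- by rewrite [psi 0](_ : _ = cst 1); [exact: cvg_cst|apply/funext=> z; exact: psi0].
- by rewrite [psi 1](_ : _ = id); [exact: cvg_id|apply/funext=> z; exact: psi1].
- rewrite [psi n.+2](_ : _ = fun z => z * psi n.+1 z - psi n z).
    by apply: cvgB; [apply: cvgM; [exact: cvg_id|exact: IH1]|exact: IH0].
  by apply/funext => z; exact: psiSS.
Qed.

Lemma continuous_csum n s : continuous (fun x => csum n (x :: s) : R).
Proof.
move=> x; rewrite /continuous_at csum_cons; under eq_fun do rewrite csum_cons.
apply: (@cvg_sum_fun _ _ _ _ _ (fun i z => psi i z * csum (n - i) s) (fun i => psi i x * csum (n - i) s)) => i.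
by apply: cvgM; [exact: continuous_psi|exact: cvg_cst].
Qed.

Lemma continuous_csum2 n x s : continuous (fun y => csum n (x :: y :: s) : R).
Proof.
move=> y; rewrite /continuous_at csum_cons; under eq_fun do rewrite csum_cons.
apply: (@cvg_sum_fun _ _ _ _ _ (fun i z => psi i x * csum (n - i) (z :: s)) (fun i => psi i x * csum (n - i) (y :: s))) => i.
by apply: cvgM; [exact: cvg_cst|exact: continuous_csum].
Qed.

(** Each derivative in the first variable turns [csum n.+1] into [csum n] with one more variable and
    kills [csum 0], which is constant; the coefficients shift by one. *)
Lemma nc_deriven_series f b m s : rapid b ->
  (forall x, seg x -> series (fun n => b n * psi n x) @ \oo --> f x) ->
  size s = m.+1 -> all (fun x => `[< seg x >]) s ->
  series (fun n => b (n + m)%N * csum n s) @ \oo --> nc_deriven m f s.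
Proof.
move=> rb bf; elim: m s => [|m IH] [|x s]//=.
  case: s => //= _ /andP[/asboolP sx _].
  have -> : (fun n => b (n + 0)%N * csum n [:: x]) = (fun n => b n * psi n x).
    by apply/funext => n; rewrite addn0 csum1.
  exact: bf.
case: s => //= y s [ss] /and3P[/asboolP sx /asboolP sy As].
pose g n z := b (n + m)%N * csum n (z :: s).
pose h n z := b (n + m.+1)%N * csum n (x :: z :: s).
(* The series of [f] starts with a constant term, whose derivative is 0. The sequences [h'] and [M']
   are [h] and [M] with this zero term in front, so that indices agree with those of [g]; the shift
   is undone at the end. *)
pose h' n z := if n is n'.+1 then h n' z else 0.
pose M n := `|b (n + m.+1)%N| * n.+1%:R ^+ (2 * m.+2).
pose M' n := if n is n'.+1 then M n' else 0.
have cM : cvgn (series M).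
  by apply: (@rapid_summable _ (fun n => b (n + m.+1)%N)); exact: rapid_shift.
have sM' : (fun n => series M' (n + 1)%N) = series M.
  apply/funext => n; rewrite addn1 /series /= big_nat_recl//= add0r.
  by [].
have cM' : cvgn (series M').
  by apply/cvg_ex; exists (limn (series M)); rewrite -(cvg_shiftn 1) sM'.
have [D hD ncD] : exists2 D, series (fun n => h' n y) @ \oo --> D &
   nc_derive (fun z => nc_deriven m f (z :: s)) x y = D.
  apply: (@nc_derive_series _ g h' M') => //.
  - move=> z sz; apply: IH; rewrite /= ?ss//.
    by rewrite As andbT; apply/asboolP.
  - move=> [|n] z; rewrite /g /h' /h.
      by rewrite !csum0 subrr mulr0.
    by rewrite -mulrBr csum_divdiff addSnnS; ring.
  - move=> [|n] z; first exact: cvg_cst.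
    by apply: cvgM; [exact: cvg_cst|exact: continuous_csum2].
  - move=> [|n] z sz; first by rewrite normr0.
    rewrite /h' /h /M' /M normrM ler_wpM2l//.
    have -> : m.+2 = size (x :: z :: s) by rewrite /= ss.
    by apply: csum_bound => /=; rewrite As andbT; apply/andP; split; apply/asboolP.
rewrite ncD.
have -> : series (fun n => b (n + m.+1)%N * csum n [:: x, y & s]) =
    (fun n => series (h' ^~ y) (n + 1)%N).
  by apply/funext => n; rewrite addn1 /series /= big_nat_recl//= add0r.
by rewrite cvg_shiftn.
Qed.

End nc_derive_series.

(** * Integration of bounded measurable functions *)

Section bounded_measurable.
Context d (T : measurableType d) (R : realType).
Variables (mu : {measure set T -> \bar R}) (D : set T) (mD : measurable D).
Implicit Types (f g F : T -> R).

Definition bounded_mfun f := measurable_fun D f /\ exists M, forall x, D x -> `|f x| <= M.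

Lemma bounded_mfun_cst c : bounded_mfun (fun=> c).
Proof. by split; [exact: measurable_cst|exists `|c|]. Qed.

Lemma bounded_mfunD f g : bounded_mfun f -> bounded_mfun g -> bounded_mfun (fun x => f x + g x).
Proof.
move=> [mf [M fM]] [mg [N gN]]; split; first exact: measurable_funD.
by exists (M + N) => x Dx; rewrite (le_trans (ler_normD _ _))// lerD ?fM ?gN.
Qed.

Lemma bounded_mfunM f g : bounded_mfun f -> bounded_mfun g -> bounded_mfun (fun x => f x * g x).
Proof.
move=> [mf [M fM]] [mg [N gN]]; split; first exact: measurable_funM.
by exists (M * N) => x Dx; rewrite normrM ler_pM ?fM ?gN.
Qed.

Lemma bounded_mfunZ c f : bounded_mfun f -> bounded_mfun (fun x => c * f x).
Proof. by apply: bounded_mfunM; exact: bounded_mfun_cst. Qed.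

Lemma bounded_mfunB f g : bounded_mfun f -> bounded_mfun g -> bounded_mfun (fun x => f x - g x).
Proof.
move=> bf bg; have := bounded_mfunD bf (bounded_mfunZ (-1) bg).
by under eq_fun do rewrite mulN1r.
Qed.

Lemma bounded_mfun_sum n (f : nat -> T -> R) :
  (forall i, bounded_mfun (f i)) -> bounded_mfun (fun x => \sum_(i < n) f i x).
Proof.
move=> bf; elim: n => [|n IH].
  by under eq_fun do rewrite big_ord0; exact: bounded_mfun_cst.
by under eq_fun do rewrite big_ord_recr /=; exact: bounded_mfunD.
Qed.

Lemma integrable_bounded_mfun g f : mu.-integrable D (EFin \o g) -> bounded_mfun f ->
  mu.-integrable D (EFin \o (fun x => g x * f x)).
Proof.
move=> ig [mf [M fM]].
have -> : EFin \o (fun x => g x * f x) = ((EFin \o g) \* (EFin \o f))%E by exact/funext.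
apply: integrableMl => //; exists M; split; first exact: num_real.
by move=> N MN x /= Dx; rewrite (le_trans (fM x Dx))// ltW.
Qed.

Lemma bounded_mfun_integrable f : (mu D < +oo)%E -> bounded_mfun f -> mu.-integrable D (EFin \o f).
Proof.
move=> muD [mf [M fM]]; apply: measurable_bounded_integrable => //.
exists M; split; first exact: num_real.
by move=> N MN x /= Dx; rewrite (le_trans (fM x Dx))// ltW.
Qed.

Lemma bounded_mfun_series (f : nat -> T -> R) F (M : R ^nat) :
  (forall n, measurable_fun D (f n)) -> (forall n x, D x -> `|f n x| <= M n) ->
  cvgn (series M) -> (forall x, D x -> series (f ^~ x) @ \oo --> F x) ->
  bounded_mfun F.
Proof.
move=> mf fM cM fF; split.
  apply: (@measurable_fun_cvg _ _ _ _ (fun N x => series (f ^~ x) N)) => // m.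
  rewrite /series /=; exact: measurable_sum.
exists (limn (series M)) => x Dx.
have := @series_remainder_le _ (f ^~ x) M (F x) 0 (fun n => fM n x Dx) cM (fF x Dx).
by rewrite /series /= !big_geq// !subr0.
Qed.

(** The error after [N] terms is at most the integral of [|g|] times the tail of the series of the
    [M n]. The factor [g] is merely integrable, so it may later be a function known only to lie in
    L^2. *)
Lemma Rintegral_series g (f : nat -> T -> R) F (M : R ^nat) :
  mu.-integrable D (EFin \o g) ->
  (forall n, measurable_fun D (f n)) -> (forall n x, D x -> `|f n x| <= M n) ->
  cvgn (series M) -> (forall x, D x -> series (f ^~ x) @ \oo --> F x) ->
  series (fun n => \int[mu]_(x in D) (g x * f n x)) @ \oo -->
  \int[mu]_(x in D) (g x * F x).
Proof.
move=> ig mf fM cM fF.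
have bf n : bounded_mfun (f n) by split=> //; exists (M n) => x Dx; exact: fM.
have bF : bounded_mfun F := bounded_mfun_series mf fM cM fF.
pose S N x := series (f ^~ x) N.
have bS N : bounded_mfun (S N).
  by rewrite /S; under eq_fun do rewrite seriesEord; exact: bounded_mfun_sum.
have SE N : series (fun n => \int[mu]_(x in D) (g x * f n x)) N =
    \int[mu]_(x in D) (g x * S N x).
  elim: N => [|N IH].
    rewrite /S /series /= big_geq//.
    under eq_Rintegral do rewrite big_geq// mulr0.
    by rewrite Rintegral_cst ?mul0r.
  rewrite seriesSr IH -RintegralD//; [|exact: integrable_bounded_mfun..].
  by apply: eq_Rintegral => x _; rewrite /S seriesSr mulrDr.
have -> : series (fun n => \int[mu]_(x in D) (g x * f n x)) =
    (fun N => \int[mu]_(x in D) (g x * S N x)) by exact/funext.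
pose t N := limn (series M) - series M N.
have t0 : t N @[N --> \oo] --> 0.
  rewrite -(subrr (limn (series M))); apply: cvgB => //; exact: cvg_cst.
have ing : mu.-integrable D (EFin \o (fun x => `|g x|)).
  exact: (integrable_norm ig).
pose I := \int[mu]_(x in D) `|g x|.
have bound N : `|\int[mu]_(x in D) (g x * S N x) - \int[mu]_(x in D) (g x * F x)| <= I * t N.
  rewrite -RintegralB//; [|exact: integrable_bounded_mfun..].
  have bSF : bounded_mfun (fun x => S N x - F x) by exact: bounded_mfunB.
  rewrite (_ : \int[mu]_(x in D) _ = \int[mu]_(x in D) (g x * (S N x - F x))); last first.
    by apply: eq_Rintegral => x _; rewrite mulrBr.
  apply: (le_trans (le_normr_Rintegral _ _)) => //; first exact: integrable_bounded_mfun.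
  rewrite /I -RintegralZr//; apply: le_Rintegral => //.
  - by apply: (integrable_norm); exact: integrable_bounded_mfun.
  - exact: (integrable_bounded_mfun ing (bounded_mfun_cst (t N))).
  - move=> x Dx; rewrite normrM ler_wpM2l// distrC.
    exact: (series_remainder_le N (fun n => fM n x Dx) cM (fF x Dx)).
apply/cvgrPdist_le => e e0.
have : I * t N @[N --> \oo] --> I * 0 by apply: cvgM => //; exact: cvg_cst.
rewrite mulr0 => /cvgrPdist_le/(_ e e0); apply: filterS => N.
rewrite sub0r normrN => h; rewrite distrC; apply: (le_trans (bound N)).
exact: le_trans (ler_norm _) h.
Qed.

End bounded_measurable.

(** * Integrals against a measure with density *)

Section density.
Context {R : realType} (p : measurableTypeR R -> R).
Hypotheses (p_ge0 : forall x, 0 <= p x) (mp : measurable_fun setT p).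
Local Notation mu := (@lebesgue_measure R).
Local Notation m := (with_density p_ge0 mp).
Local Open Scope ereal_scope.

Let integral_density_indic E : measurable E ->
  \int[m]_x (\1_E x)%:E = \int[mu]_x ((\1_E x)%:E * (p x)%:E).
Proof.
move=> mE; rewrite integral_indic//= setIT /with_density integral_mkcond.
apply: eq_integral => x _; rewrite patchE indicE.
by case: ifPn => xE; rewrite /= ?mul1e ?mul0e.
Qed.

Import HBNNSimple.

Let mpe : measurable_fun setT (EFin \o p).
Proof. exact/measurable_EFinP. Qed.

Let integral_density_nnsfun (f : {nnsfun _ >-> R}) :
  \int[m]_x (f x)%:E = \int[mu]_x ((f x)%:E * (p x)%:E).
Proof.
under [LHS]eq_integral do rewrite fimfunE -fsumEFin//.
rewrite [LHS]ge0_integral_fsum//; last 2 first.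
  - by move=> r; exact/measurable_EFinP/measurableT_comp.
  - by move=> n x _; rewrite EFinM nnfun_muleindic_ge0.
under [RHS]eq_integral.
  move=> x xD; rewrite fimfunE -fsumEFin// ge0_mule_fsuml; last first.
    by move=> r; rewrite EFinM nnfun_muleindic_ge0.
  over.
rewrite [RHS]ge0_integral_fsum//; last 2 first.
  - move=> r; apply: emeasurable_funM => //.
    by apply/measurable_EFinP/measurableT_comp.
  - by move=> n x _; rewrite EFinM mule_ge0//; rewrite ?nnfun_muleindic_ge0 ?lee_fin.
apply: eq_fsbigr => r _.
rewrite integralZl_indic_nnsfun//= integral_density_indic//.
under [RHS]eq_integral do rewrite EFinM -muleA.
have [r0|r0] := leP 0%R r.
  rewrite ge0_integralZl//.
  - by apply: emeasurable_funM => //; exact/measurable_EFinP/measurable_indic.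
  - by move=> x _; rewrite mule_ge0// lee_fin.
(* A nonnegative simple function never takes the negative value [r], so both integrals are over an
   empty level set. *)
rewrite preimage_nnfun0// !integral0_eq ?mule0// => x _.
- by rewrite indic0 mul0e.
- by rewrite indic0 mul0e mule0.
Qed.

(** Simple functions increasing to [f] reduce the claim to [integral_density_nnsfun], with monotone
    convergence applied under both measures. *)
Let ge0_integral_densityT (f : _ -> \bar R) :
  measurable_fun setT f -> (forall x, 0 <= f x) ->
  \int[m]_x f x = \int[mu]_x (f x * (p x)%:E).
Proof.
move=> mf f0.
pose f_ := nnsfun_approx measurableT mf.
transitivity (lim (\int[m]_x (f_ n x)%:E @[n --> \oo])).
  rewrite -monotone_convergence//=.
  - apply: eq_integral => ? /[!inE] xD; apply/esym/cvg_lim => //=.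
    exact: cvg_nnsfun_approx.
  - by move=> n; exact/measurable_EFinP/measurable_funTS.
  - by move=> n ? _; rewrite lee_fin.
  - by move=> ? _ ? ? mn; rewrite lee_fin; exact/lefP/nd_nnsfun_approx.
transitivity (lim (\int[mu]_x ((f_ n x)%:E * (p x)%:E) @[n --> \oo])).
  by congr (limn _); apply/funext => n; exact: integral_density_nnsfun.
rewrite -monotone_convergence//=.
- apply: eq_integral => x _; apply/cvg_lim => //=.
  apply: cvgeZr => //; exact: cvg_nnsfun_approx.
- move=> n; apply: emeasurable_funM => //.
  exact/measurable_EFinP/measurable_funTS.
- by move=> n ? _; rewrite mule_ge0// lee_fin.
- move=> x _ a b ab; rewrite lee_wpmul2r// lee_fin//.
  exact/lefP/nd_nnsfun_approx.
Qed.

Lemma ge0_integral_density D (f : _ -> \bar R) : measurable D ->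
  measurable_fun D f -> (forall x, D x -> 0 <= f x) ->
  \int[m]_(x in D) f x = \int[mu]_(x in D) (f x * (p x)%:E).
Proof.
move=> mD mf f0; rewrite integral_mkcond [RHS]integral_mkcond.
rewrite ge0_integral_densityT//; last 2 first.
- exact/(measurable_restrictT f).
- by move=> x; exact: erestrict_ge0.
apply: eq_integral => x _; rewrite !patchE.
by case: ifPn => //; rewrite mul0e.
Qed.

Lemma integral_density D (f : _ -> \bar R) : measurable D ->
  measurable_fun D f ->
  \int[m]_(x in D) f x = \int[mu]_(x in D) (f x * (p x)%:E).
Proof.
move=> mD mf; rewrite integralE [RHS]integralE.
rewrite ge0_integral_density//; last exact: measurable_funepos.
rewrite ge0_integral_density//; last exact: measurable_funeneg.
by congr (_ - _); apply: eq_integral => x _;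
  rewrite unlock maxe_pMl ?lee_fin// mul0e ?mulNe.
Qed.

Lemma Rintegral_density D (f : R -> R) : measurable D ->
  measurable_fun D f ->
  (\int[m]_(x in D) f x = \int[mu]_(x in D) (f x * p x))%R.
Proof.
move=> mD mf; rewrite /Rintegral integral_density//.
exact/measurable_EFinP.
Qed.

End density.

(** * The arcsine law as the image of the uniform law *)

Section arcsine_integral.
Context {R : realType}.
Local Notation mu := (@lebesgue_measure R).
Local Notation T := (measurableTypeR R).
Implicit Types (f : R -> R) (x t : R).

Lemma measurable_seg : measurable (seg : set T).
Proof. exact: measurable_itv. Qed.
Hint Resolve measurable_seg : core.

Definition seg_cont f := {within (seg : set R), continuous f}.

Lemma seg_cont_measurable f : seg_cont f -> measurable_fun (seg : set T) f.
Proof. by move=> cf; exact: subspace_continuous_measurable_fun. Qed.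

Lemma continuous_seg_cont f : continuous f -> seg_cont f.
Proof. exact: continuous_subspaceT. Qed.

Lemma seg_contP f : seg_cont f <-> forall x, seg x -> f y @[y --> within seg (nbhs x)] --> f x.
Proof. exact: subspace_continuousP. Qed.

(** Continuity of [f] relative to the segment is enough, because [2 cos] sends the whole line into
    it. The values of the extension of [f] outside the segment are never met. *)
Lemma seg_cont_comp_cos f : seg_cont f -> continuous (fun t => f (2 * cos t)).
Proof.
move=> /seg_contP cf t; have ct : {for t, continuous (fun t => 2 * cos t : R)}.
  by apply: cvgM; [exact: cvg_cst|exact: continuous_cos].
apply: (@cvg_comp _ _ _ (fun t => 2 * cos t) f _ (within seg (nbhs (2 * cos t)))).
  move=> A /= ; rewrite /within /= => h; have := ct _ h.
  apply: (@filterS _ (nbhs t)) => s /=; apply; exact: seg_cos.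
by apply: cf; exact: seg_cos.
Qed.

Lemma seg_cont_bounded_mfun f : seg_cont f -> bounded_mfun (seg : set T) f.
Proof.
move=> cf; split; first exact: seg_cont_measurable.
have cc : {within `[0, pi], continuous (fun t => `|f (2 * cos t)|)}.
  apply: continuous_subspaceT => t; apply: cvg_norm; exact: seg_cont_comp_cos.
have [c _ cM] := EVT_max (pi_ge0 R) cc.
exists (`|f (2 * cos c)|) => x /seg_cosP[t t0 ->]; exact: cM.
Qed.

(** On the segment the semicircular density is [(4 - x^2) / 2] times the arcsine density, so all
    integrals can be computed under the arcsine law. *)
Lemma Rintegral_semicircle f : measurable_fun (seg : set T) f ->
  \int[semicircle R]_(x in seg) f x =
  \int[arcsine R]_(x in seg) (f x * ((4 - x ^+ 2) / 2)).
Proof.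
move=> mf; rewrite /semicircle Rintegral_density// /arcsine Rintegral_density//; last first.
  apply: measurable_funM => //; apply: measurable_funTS.
  apply: continuous_measurable_fun => x; apply: cvgM; last exact: cvg_cst.
  by apply: cvgB; [exact: cvg_cst|exact: exprn_continuous].
apply: eq_Rintegral => x; rewrite inE => /seg_itv /andP[x1 x2]; rewrite -mulrA; congr (_ * _).
rewrite /semicircle_pdf /arcsine_pdf.
have x4 : 0 <= 4 - x ^+ 2 by nra.
have pn0 : pi != 0 :> R by rewrite gt_eqF// pi_gt0.
rewrite -[X in X / 2 * _](sqr_sqrtr x4).
(* At the endpoints the square root is 0 and both sides vanish; elsewhere it can be cancelled. *)
have [->|s0] := eqVneq (Num.sqrt (4 - x ^+ 2)) 0; first by rewrite expr0n/= !mul0r.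
by move: (pi : R) pn0 => p pn0; field; rewrite s0 pn0.
Qed.

Let c t : R := 2 * cos t.

Let dc t : is_derive t 1 c (- (2 * sin t)).
Proof. by rewrite /c; apply: is_derive_eq; rewrite /GRing.scale /=; ring. Qed.

Let Dc : derive1 c = (fun t => - (2 * sin t)).
Proof. by apply/funext => t; rewrite derive1E; exact: derive_val. Qed.

Let cDc : continuous (derive1 c).
Proof.
rewrite Dc => t; apply: cvgN; apply: cvgM; [exact: cvg_cst|].
exact: continuous_sin.
Qed.

Let cc : continuous c.
Proof. by move=> t; apply: cvgM; [exact: cvg_cst|exact: continuous_cos]. Qed.

Let c0 : c 0 = 2.
Proof. by rewrite /c cos0 mulr1. Qed.

Let cpi : c pi = -2.
Proof. by rewrite /c cospi mulrN1. Qed.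

Let c_decr s t : s \in `[0, pi] -> t \in `[0, pi] -> s < t -> c t < c s.
Proof. by move=> s0 t0 st; rewrite /c ltr_pM2l// ltr_cos. Qed.

Let c_le s t : s \in `[0, pi] -> t \in `[0, pi] -> s <= t -> c t <= c s.
Proof.
by move=> s0 t0; rewrite le_eqVlt => /predU1P[->//|st]; exact/ltW/c_decr.
Qed.

Lemma seg_cont_max0 f : seg_cont f -> seg_cont (fun x => Num.max (f x) 0).
Proof.
move=> /seg_contP cf; rewrite (_ : (fun x => _) = fun x => (f x + `|f x|) / 2).
  apply/seg_contP => x sx; apply: cvgM; last exact: cvg_cst.
  by apply: cvgD; [exact: cf|apply: cvg_norm; exact: cf].
by apply/funext => x; case: leP => h; [rewrite ler0_norm|rewrite gtr0_norm]; lra.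
Qed.

(** The arcsine density is unbounded near -2 and 2, so the substitution [x = 2 cos t] is made on a
    smaller interval where the integrand is continuous. The Jacobian [2 sin t] cancels the square
    root and leaves the constant density [1 / pi]. *)
Lemma arcsine_substitution_inner f (e : R) : 0 < e -> e <= pi - e -> seg_cont f ->
  (\int[mu]_(x in `[c (pi - e)%R, c e]) (f x * arcsine_pdf x)%:E =
   \int[mu]_(t in `[e, (pi - e)%R]) (f (2 * cos t)%R / pi)%:E)%E.
Proof.
move=> e0 ee cf.
have pi0 := pi_gt0 R.
have sub t : t \in `[e, pi - e] -> t \in `]0, pi[.
  by rewrite !in_itv /= => /andP[h1 h2]; apply/andP; split; lra.
have sub' t : t \in `[e, pi - e] -> t \in `[0, pi].
  by move=> /sub; exact: subset_itv_oo_cc.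
rewrite (@integration_by_substitution_decreasing _ c)//; last 5 first.
- by move=> s t s0 t0 st; apply: c_decr => //; exact: sub'.
- by apply/cvg_ex; exists (derive1 c e); apply: cvg_at_right_filter; exact: cDc.
- by apply/cvg_ex; exists (derive1 c (pi - e)); apply: cvg_at_left_filter; exact: cDc.
- split; first by move=> t _; exact: ex_derive.
    by apply: cvg_at_right_filter; exact: cc.
  by apply: cvg_at_left_filter; exact: cc.
- have E0 : e \in `[e, pi - e] by rewrite in_itv /= lexx ee.
  have E1 : pi - e \in `[e, pi - e] by rewrite in_itv /= lexx ee.
  have c2 : c e < 2.
    rewrite -c0; apply: c_decr => //.
    - by rewrite in_itv /= lexx ltW.
    - exact: sub'.
  have c2' : -2 < c (pi - e).
    rewrite -cpi; apply: c_decr => //.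
    - exact: sub'.
    - by rewrite in_itv /= lexx ltW.
    - lra.
  have subseg : `[c (pi - e), c e] `<=` (seg : set R).
    move=> x /=; rewrite in_itv/= => /andP[h1 h2].
    by apply/seg_itv/andP; split; lra.
  apply/subspace_continuousP => x xI; apply: cvgM.
    have /subspace_continuousP := continuous_subspaceW subseg cf.
    exact.
  apply: cvg_within_filter; apply: cvgV.
    rewrite mulf_neq0 ?gt_eqF//; move: xI; rewrite /= in_itv /= => /andP[h1 h2].
    by rewrite sqrtr_gt0; nra.
  apply: cvgM; first exact: cvg_cst.
  apply: (@continuous_comp _ _ _ (fun x => 4 - x ^+ 2) Num.sqrt); last exact: sqrt_continuous.
  by apply: cvgB; [exact: cvg_cst|exact: exprn_continuous].
apply: eq_integral => t; rewrite inE /= => /sub; rewrite in_itv /= => t0.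
congr EFin; rewrite Dc /c /arcsine_pdf fctE /= opprK.
have -> : 4 - (2 * cos t) ^+ 2 = (2 * sin t) ^+ 2 :> R.
  by rewrite !exprMn sin2cos2; ring.
have st : 0 < sin t by rewrite sin_gt0_pi// in_itv.
rewrite sqrtr_sqr gtr0_norm ?mulr_gt0//.
move: (pi : R) pi0 (sin t) st => p p0 s s0; field.
by rewrite !gt_eqF.
Qed.

(** A margin tending to 0; the denominator [n + 2] keeps it at most [pi / 2], so that
    [[ep n, pi - ep n]] is never empty. *)
Let ep n : R := pi / n.+2%:R.

Let ep0 n : 0 < ep n.
Proof. by rewrite /ep divr_gt0 ?pi_gt0. Qed.

Let ep_le n : ep n <= pi - ep n.
Proof.
have pi0 := pi_gt0 R.
suff : ep n <= pi / 2 by lra.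
by rewrite /ep ler_pM2l// lef_pV2 ?posrE// ler_nat.
Qed.

Let ep_decr m n : (m <= n)%N -> ep n <= ep m.
Proof.
by move=> mn; rewrite /ep ler_pM2l ?pi_gt0// lef_pV2 ?posrE// ler_nat.
Qed.

Let ep_bigcup t : 0 < t < pi -> exists n, ep n <= t <= pi - ep n.
Proof.
move=> /andP[t0 t1]; pose d := Num.min t (pi - t).
have d0 : 0 < d by rewrite lt_min t0 subr_gt0.
have [n nd] : exists n : nat, pi / d < n%:R by exists (Num.bound (pi / d)); apply: archi_boundP; rewrite divr_ge0 ?pi_ge0// ltW.
exists n.
have : ep n <= d.
  rewrite /ep ler_pdivrMr// mulrC -ler_pdivrMr//; apply: le_trans (ltW nd) _.
  by rewrite ler_nat; lia.
by rewrite le_min => /andP[h1 h2]; apply/andP; split; lra.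
Qed.

(** The inner intervals increase to the open intervals on both sides, and the endpoints are Lebesgue
    null. Nonnegativity gives convergence of the integrals along these increasing sets. *)
Lemma ge0_arcsine_substitution f : seg_cont f -> (forall x, 0 <= f x) ->
  (\int[mu]_(x in seg) (f x * arcsine_pdf x)%:E =
   \int[mu]_(t in `[0%R, pi]) (f (2 * cos t)%R / pi)%:E)%E.
Proof.
move=> cf f0.
have pi0 := pi_gt0 R.
have mf : measurable_fun (seg : set T) (fun x => (f x * arcsine_pdf x)%:E).
  apply/measurable_EFinP; apply: measurable_funM; first exact: seg_cont_measurable.
  by apply: measurable_funTS; exact: measurable_arcsine_pdf.
have mg (A : set T) : measurable_fun A (fun t => (f (2 * cos t)%R / pi)%:E).
  apply/measurable_EFinP/measurable_funTS; apply: continuous_measurable_fun => t.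
  by apply: cvgM; [exact: seg_cont_comp_cos|exact: cvg_cst].
have in0 t n : t \in `[ep n, pi - ep n] -> t \in `[0, pi].
  by have := ep0 n; rewrite !in_itv /= => h /andP[h1 h2]; apply/andP; split; lra.
pose F n := `[c (pi - ep n), c (ep n)]%classic : set T.
pose G n := `[ep n, (pi - ep n)]%classic : set T.
have FU : \bigcup_n F n = `](-2), 2[%classic.
  apply/seteqP; split=> x.
    move=> [n _]; rewrite /F /= !in_itv /= => /andP[h1 h2].
    have i1 : ep n \in `[0, pi] by apply: (in0 _ n); rewrite in_itv /= lexx ep_le.
    have i2 : pi - ep n \in `[0, pi] by apply: (in0 _ n); rewrite in_itv /= lexx ep_le.
    have : c (ep n) < c 0.
      by apply: c_decr => //; rewrite in_itv /= lexx ltW.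
    have : c pi < c (pi - ep n).
      apply: c_decr => //; first by rewrite in_itv /= lexx ltW.
      by have := ep0 n; lra.
    by rewrite c0 cpi => ? ?; apply/andP; split; lra.
  rewrite /= in_itv /= => /andP[x1 x2].
  have /seg_cosP[t] : seg x by apply/seg_itv/andP; split; lra.
  rewrite in_itv /= => /andP[t0 t1] xt.
  have [] : exists n, ep n <= t <= pi - ep n.
    apply: ep_bigcup; apply/andP; split.
      by rewrite lt_neqAle t0 andbT; apply/eqP => t00; move: x2; rewrite xt -t00 cos0; lra.
    by rewrite lt_neqAle t1 andbT; apply/eqP => t00; move: x1; rewrite xt t00 cospi; lra.
  move=> n tn; exists n => //; rewrite /F /= in_itv /= xt -/(c t).
  move: (tn) => /andP[tn1 tn2].
  have it : t \in `[0, pi] by apply: (in0 _ n); rewrite in_itv.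
  have i1 : ep n \in `[0, pi] by apply: (in0 _ n); rewrite in_itv /= lexx ep_le.
  have i2 : pi - ep n \in `[0, pi] by apply: (in0 _ n); rewrite in_itv /= lexx ep_le.
  by apply/andP; split; exact: c_le.
have GU : \bigcup_n G n = `]0%R, pi[%classic.
  apply/seteqP; split=> x.
    move=> [n _]; rewrite /G /= !in_itv /= => /andP[h1 h2].
    by have := ep0 n => ?; apply/andP; split; lra.
  rewrite /= in_itv /= => /ep_bigcup[n xn]; by exists n.
have Gnd : nondecreasing_seq G.
  move=> m n mn; apply/subsetPset => x; rewrite /G /= !in_itv /= => /andP[h1 h2].
  by have := ep_decr mn => ?; apply/andP; split; lra.
have Fnd : nondecreasing_seq F.
  move=> m n mn; apply/subsetPset => x; rewrite /F /= !in_itv /= => /andP[h1 h2].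
  have i n' : ep n' \in `[0, pi] by apply: (in0 _ n'); rewrite in_itv /= lexx ep_le.
  have i' n' : pi - ep n' \in `[0, pi] by apply: (in0 _ n'); rewrite in_itv /= lexx ep_le.
  have H1 : c (ep m) <= c (ep n) by apply: c_le => //; exact: ep_decr.
  have H2 : c (pi - ep n) <= c (pi - ep m).
    by apply: c_le => //; rewrite lerD2l lerN2 ep_decr.
  by apply/andP; split; [exact: le_trans h1|exact: le_trans H1].
rewrite /seg integral_itv_bndoo; last first.
  by apply: measurable_funS mf => //; exact: subset_itv_oo_cc.
rewrite [RHS]integral_itv_bndoo -?FU -?GU; last exact: mg.
have cF : (fun n => \int[mu]_(x in F n) (f x * arcsine_pdf x)%:E)%E @ \oo -->
    (\int[mu]_(x in \bigcup_n F n) (f x * arcsine_pdf x)%:E)%E.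
  apply: ge0_nondecreasing_set_cvg_integral => //.
  - by move=> n; exact: measurable_itv.
  - move=> n; apply: measurable_funS mf => //.
    have : F n `<=` \bigcup_n F n by exact: bigcup_sup.
    by rewrite FU => h; apply: (subset_trans h); exact: subset_itv_oo_cc.
  - by move=> n x _; rewrite lee_fin mulr_ge0// arcsine_pdf_ge0.
have cG : (fun n => \int[mu]_(t in G n) (f (2 * cos t)%R / pi)%:E)%E @ \oo -->
    (\int[mu]_(t in \bigcup_n G n) (f (2 * cos t)%R / pi)%:E)%E.
  apply: ge0_nondecreasing_set_cvg_integral => //.
  - by move=> n; exact: measurable_itv.
  - by move=> n x _; rewrite lee_fin divr_ge0// ltW.
have FG : (fun n => \int[mu]_(x in F n) (f x * arcsine_pdf x)%:E)%E =
    (fun n => \int[mu]_(t in G n) (f (2 * cos t)%R / pi)%:E)%E.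
  by apply/funext => n; exact: arcsine_substitution_inner.
by rewrite FG in cF; exact: cvg_unique cF cG.
Qed.

(** Positive and negative parts of a continuous function are continuous, and multiplication by a
    nonnegative density commutes with taking them; the nonnegative case applies to each. *)
Lemma arcsine_substitution f : seg_cont f ->
  \int[arcsine R]_(x in seg) f x = \int[mu]_(t in `[0, pi]) (f (2 * cos t) / pi).
Proof.
move=> cf; rewrite /arcsine Rintegral_density//; last exact: seg_cont_measurable.
rewrite /Rintegral; congr fine.
have pi0 := pi_gt0 R.
have cp := seg_cont_max0 cf.
have cn : seg_cont (fun x => Num.max (- f x) 0).
  by apply: (@seg_cont_max0 (fun x => - f x)); apply/seg_contP => x sx; apply: cvgN; exact: (seg_contP f).1.
rewrite integralE [RHS]integralE.
have gp (x : R) : 0 <= Num.max x 0 :> R by rewrite le_max lexx orbT.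
have -> : (\int[mu]_(x in seg) ((fun x => (f x * arcsine_pdf x)%:E)^\+ x) =
    \int[mu]_(t in `[0%R, pi]) ((fun t => (f (2 * cos t)%R / pi)%:E)^\+ t))%E.
  transitivity (\int[mu]_(x in seg) ((Num.max (f x) 0 * arcsine_pdf x)%:E))%E.
    by apply: eq_integral => x _; rewrite funeposE maxr_pMl ?arcsine_pdf_ge0// mul0r EFin_max.
  rewrite ge0_arcsine_substitution//.
  apply: eq_integral => x _; rewrite funeposE maxr_pMl ?mul0r ?EFin_max//.
  by rewrite invr_ge0 ltW.
congr (_ - _)%E.
transitivity (\int[mu]_(x in seg) ((Num.max (- f x) 0 * arcsine_pdf x)%:E))%E.
  by apply: eq_integral => x _; rewrite funenegE maxr_pMl ?arcsine_pdf_ge0// mul0r EFin_max mulNr.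
rewrite ge0_arcsine_substitution//.
apply: eq_integral => x _; rewrite funenegE maxr_pMl ?mul0r ?EFin_max ?mulNr//.
by rewrite invr_ge0 ltW.
Qed.

Lemma arcsine_seg_lty : (arcsine R (seg : set T) < +oo)%E.
Proof.
have -> : arcsine R (seg : set T) = (\int[mu]_(x in seg) (cst 1 x * arcsine_pdf x)%:E)%E.
  by rewrite /arcsine /with_density; apply: eq_integral => x _; rewrite mul1r.
rewrite ge0_arcsine_substitution//; last by apply: continuous_seg_cont => x; exact: cvg_cst.
rewrite (eq_integral (cst (pi^-1)%:E)); last by move=> t _; rewrite mul1r.
rewrite integral_cst//= lebesgue_measure_itv /= lte_fin pi_gt0 -EFinB.
by rewrite -EFinM ltry.
Qed.

End arcsine_integral.

(** * Continuous functions under the arcsine law and orthogonality of the [tcheb] *)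

Section seg_continuous.
Context {R : realType}.
Implicit Types (f g : R -> R) (x : R).

Lemma seg_cont_cst (c : R) : seg_cont (fun=> c).
Proof. by apply: continuous_seg_cont => x; exact: cvg_cst. Qed.

Lemma seg_cont_id : seg_cont (fun x : R => x).
Proof. by apply: continuous_seg_cont => x; exact: cvg_id. Qed.

Lemma seg_contD f g : seg_cont f -> seg_cont g -> seg_cont (fun x => f x + g x).
Proof. by move=> /seg_contP cf /seg_contP cg; apply/seg_contP => x sx; apply: cvgD; [exact: cf|exact: cg]. Qed.

Lemma seg_contM f g : seg_cont f -> seg_cont g -> seg_cont (fun x => f x * g x).
Proof. by move=> /seg_contP cf /seg_contP cg; apply/seg_contP => x sx; apply: cvgM; [exact: cf|exact: cg]. Qed.

Lemma seg_contB f g : seg_cont f -> seg_cont g -> seg_cont (fun x => f x - g x).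
Proof. by move=> /seg_contP cf /seg_contP cg; apply/seg_contP => x sx; apply: cvgB; [exact: cf|exact: cg]. Qed.

Lemma seg_contZ (c : R) f : seg_cont f -> seg_cont (fun x => c * f x).
Proof. by apply: seg_contM; exact: seg_cont_cst. Qed.

Lemma seg_cont_psi n : seg_cont (psi n : R -> R).
Proof. by apply: continuous_seg_cont; exact: continuous_psi. Qed.

Lemma seg_cont_tcheb n : seg_cont (tcheb n : R -> R).
Proof.
elim/two_step_ind: n => [||n IH0 IH1]; [exact: seg_cont_cst|exact: seg_cont_id|].
by apply: seg_contB => //; apply: seg_contM => //; exact: seg_cont_id.
Qed.

Lemma seg_cont_sum n (f : nat -> R -> R) :
  (forall i, seg_cont (f i)) -> seg_cont (fun x => \sum_(i < n) f i x).
Proof.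
move=> cf; elim: n => [|n IH].
  by under eq_fun do rewrite big_ord0; exact: seg_cont_cst.
by under eq_fun do rewrite big_ord_recr /=; exact: seg_contD.
Qed.

Definition arcint f : R := \int[arcsine R]_(x in seg) f x.

Lemma seg_cont_integrable f : seg_cont f -> (arcsine R).-integrable seg (EFin \o f).
Proof.
move=> cf; apply: bounded_mfun_integrable; first exact: measurable_seg.
  exact: arcsine_seg_lty.
exact: seg_cont_bounded_mfun.
Qed.

Lemma eq_arcint f g : (forall x, seg x -> f x = g x) -> arcint f = arcint g.
Proof. by move=> fg; apply: eq_Rintegral => x; rewrite inE; exact: fg. Qed.

Lemma arcintD f g : seg_cont f -> seg_cont g -> arcint (fun x => f x + g x) = arcint f + arcint g.
Proof. by move=> cf cg; apply: RintegralD; [exact: measurable_seg|exact: seg_cont_integrable..]. Qed.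

Lemma arcintB f g : seg_cont f -> seg_cont g -> arcint (fun x => f x - g x) = arcint f - arcint g.
Proof. by move=> cf cg; apply: RintegralB; [exact: measurable_seg|exact: seg_cont_integrable..]. Qed.

Lemma arcintZ (c : R) f : seg_cont f -> arcint (fun x => c * f x) = c * arcint f.
Proof. by move=> cf; apply: RintegralZl; [exact: measurable_seg|exact: seg_cont_integrable]. Qed.

Lemma arcint_cos f : seg_cont f -> arcint f = \int[lebesgue_measure]_(t in `[0, pi]) (f (2 * cos t) / pi).
Proof. exact: arcsine_substitution. Qed.

Lemma sin_natpi n : sin (n%:R * pi) = 0 :> R.
Proof. by case: n => [|n]; rewrite ?mul0r ?sin0// -psi_cos sinpi mulr0. Qed.

Lemma is_derive_sinM (a t : R) : is_derive t 1 (fun t => sin (a * t)) (a * cos (a * t)).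
Proof.
have d1 : is_derive t 1 (fun t : R => a * t) a.
  by apply: is_derive_eq; rewrite /GRing.scale /= ; ring.
have d2 := @is_derive1_comp _ sin (fun t => a * t) t _ _ (is_derive_sin _) d1.
by apply: is_derive_eq; rewrite mulrC.
Qed.

Lemma continuous_sinM (a : R) : continuous (fun t => sin (a * t)).
Proof.
move=> t; apply: (@continuous_comp _ _ _ (fun t => a * t) sin); last exact: continuous_sin.
by apply: cvgM; [exact: cvg_cst|exact: cvg_id].
Qed.

Lemma continuous_cosM (a : R) : continuous (fun t => cos (a * t)).
Proof.
move=> t; apply: (@continuous_comp _ _ _ (fun t => a * t) cos); last exact: continuous_cos.
by apply: cvgM; [exact: cvg_cst|exact: cvg_id].
Qed.

Lemma arcint1 : arcint (fun=> 1) = 1.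
Proof.
have pi0 := pi_gt0 R.
rewrite arcint_cos; last exact: seg_cont_cst.
rewrite Rintegral_cst//= lebesgue_measure_itv /= lte_fin pi0 /= subr0.
by rewrite mul1r mulVf// gt_eqF.
Qed.

Lemma arcint_tchebS n : arcint (tcheb n.+1) = 0.
Proof.
have pi0 := pi_gt0 R.
rewrite arcint_cos; last exact: seg_cont_tcheb.
have -> : \int[lebesgue_measure]_(t in `[0, pi]) (tcheb n.+1 (2 * cos t) / pi) =
   \int[lebesgue_measure]_(t in `[0, pi]) (2 / pi * cos (n.+1%:R * t)) :> R.
  by apply: eq_Rintegral => t _; rewrite tcheb_cos mulrAC.
rewrite /Rintegral (@continuous_FTC2 _ _ (fun t => 2 / pi / n.+1%:R * sin (n.+1%:R * t)))//.
- by rewrite mulr0 sin0 sin_natpi mulr0 subee.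
- apply: continuous_subspaceT => t; apply: cvgM; first exact: cvg_cst.
  exact: continuous_cosM.
- have cG : continuous (fun t : R => 2 / pi / n.+1%:R * sin (n.+1%:R * t)).
    by move=> t; apply: cvgM; [exact: cvg_cst|exact: continuous_sinM].
  split; last 2 first.
  + by apply: cvg_at_right_filter; exact: cG.
  + by apply: cvg_at_left_filter; exact: cG.
  + by move=> t _; apply: derivableM.
- move=> t _; rewrite derive1E.
  have d := is_derive_sinM n.+1%:R t.
  rewrite deriveZ ?derive_val; last exact: ex_derive.
  by rewrite /GRing.scale /= mulrA divfK// pnatr_eq0.
Qed.

Lemma arcint_tcheb n : arcint (tcheb n) = 2 * (n == 0)%:R.
Proof.
case: n => [|n]; last by rewrite arcint_tchebS mulr0.
rewrite mulr1; have -> : tcheb 0 = (fun=> 2 * 1) :> (R -> R) by apply/funext => x; rewrite mulr1.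
by rewrite arcintZ ?arcint1 ?mulr1//; exact: seg_cont_cst.
Qed.

(** By [tchebM] the product is a sum of two [tcheb]. The larger index is never 0, and the smaller
    one is 0 exactly when [n = m]. *)
Lemma arcint_tchebM n m : arcint (fun x => tcheb n.+1 x * tcheb m.+1 x) = 2 * (n == m)%:R.
Proof.
wlog nm : n m / (n <= m)%N.
  move=> H; have [|/ltnW] := leqP n m; first exact: H.
  by move=> /H; rewrite eq_sym => <-; apply: eq_arcint => x _; rewrite mulrC.
rewrite -(subnKC nm); move: (m - n)%N => p.
rewrite (@eq_arcint _ (fun x => tcheb (n.+1 + p + n.+1) x + tcheb p x)); last first.
  by move=> x _; rewrite mulrC -addSn tchebM.
rewrite arcintD; [|exact: seg_cont_tcheb..].
rewrite !arcint_tcheb addnS mulr0 add0r; congr (_ * _%:R).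
by apply/eqP/eqP; lia.
Qed.

Lemma arcint_norm f (C : R) : seg_cont f -> (forall x, seg x -> `|f x| <= C) -> `|arcint f| <= C.
Proof.
move=> cf fC; apply: (le_trans (le_normr_Rintegral _ _)).
- exact: measurable_seg.
- exact: seg_cont_integrable.
have -> : C = arcint (fun=> C * 1) by rewrite arcintZ ?arcint1 ?mulr1//; exact: seg_cont_cst.
have ic := seg_cont_integrable (@seg_cont_cst (C * 1)).
have inf := integrable_norm (seg_cont_integrable cf).
rewrite -subr_ge0 /arcint -(RintegralB _ ic inf); last exact: measurable_seg.
by apply: Rintegral_ge0 => x sx; rewrite subr_ge0 mulr1; exact: fC.
Qed.

Lemma arcint_ge0 f : (forall x, seg x -> 0 <= f x) -> 0 <= arcint f.
Proof. by move=> f0; apply: Rintegral_ge0. Qed.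

End seg_continuous.

(** * Differentiation on the closed segment *)

Section smooth.
Context {R : realType}.
Implicit Types (f g : R -> R) (x : R).

Definition seg_derivable f := forall x, seg x ->
  cvg (diff_quotient f x y @[y --> within seg x^']).

Lemma seg_smooth_derivable f : seg_smooth f -> seg_derivable f.
Proof. by move=> sf x sx; exact: (sf 0%N x sx). Qed.

Lemma seg_smooth_derive f : seg_smooth f -> seg_smooth (seg_derive f).
Proof. by move=> sf n x sx; have := sf n.+1 x sx; rewrite iterSr. Qed.

Lemma seg_derive_cvg f x : seg_derivable f -> seg x ->
  diff_quotient f x y @[y --> within seg x^'] --> seg_derive f x.
Proof. by move=> df sx; have := df x sx. Qed.

Lemma cvg_within_seg_dnbhs (g : R -> R) x :
  g y @[y --> within seg x^'] --> g x -> g y @[y --> within seg (nbhs x)] --> g x.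
Proof.
move=> /cvgrPdist_le gx; apply/cvgrPdist_le => e e0.
have gxe : nbhs x (fun y => y != x -> seg y -> `|g x - g y| <= e) := gx e e0.
change (nbhs x (fun y => seg y -> `|g x - g y| <= e)); apply: filterS gxe => y.
have [->|yx] := eqVneq y x; first by rewrite subrr normr0 ltW.
by apply.
Qed.

Lemma cvg_dnbhs_within_seg (g : R -> R) x (l : R) :
  g y @[y --> within seg (nbhs x)] --> l -> g y @[y --> within seg x^'] --> l.
Proof.
move=> h; apply: cvg_trans h => A hA.
have {}hA : nbhs x (fun y => seg y -> A (g y)) := hA.
change (nbhs x (fun y => y != x -> seg y -> A (g y))).
by apply: filterS hA => y h _.
Qed.

Lemma seg_derivable_seg_cont f : seg_derivable f -> seg_cont f.
Proof.
move=> df; apply/seg_contP => x sx; apply: cvg_within_seg_dnbhs.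
have h : f x - diff_quotient f x y * (x - y) @[y --> within seg x^'] -->
    f x - seg_derive f x * (x - x).
  apply: cvgB; first exact: cvg_cst.
  apply: cvgM; first exact: seg_derive_cvg.
  apply: cvgB; first exact: cvg_cst.
  by apply: cvg_within_filter; apply: cvg_within_filter; exact: cvg_id.
rewrite subrr mulr0 subr0 in h.
have PF := seg_limit_point sx.
apply: cvg_trans h; apply: near_eq_cvg; near=> y.
have [sy yx] : seg y /\ y != x by near: y; exact: near_within_seg.
by rewrite /diff_quotient divfK ?subr_eq0 1?eq_sym//; ring.
Unshelve. all: by end_near. Qed.

Lemma seg_cont_smooth f : seg_smooth f -> seg_cont f.
Proof. by move/seg_smooth_derivable; exact: seg_derivable_seg_cont. Qed.

Lemma nc_deriveE f x y : f x - f y = (x - y) * nc_derive f x y.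
Proof.
rewrite /nc_derive /diff_quotient; case: eqVneq => [->|xy].
  by rewrite !subrr mul0r.
by rewrite mulrC divfK// subr_eq0.
Qed.

(** At [y = x] continuity is the definition of the derivative; elsewhere it is that of a quotient.
    It makes the factor [g] of [f - f(x) = (y - x) g] integrable, with Chebyshev coefficients of its
    own. *)
Lemma seg_cont_nc_derive f x : seg_derivable f -> seg x -> seg_cont (nc_derive f x).
Proof.
move=> df sx; apply/seg_contP => y sy.
apply: cvg_within_seg_dnbhs.
have PFx := seg_limit_point sx; have PFy := seg_limit_point sy.
have [xy|xy] := eqVneq x y.
  rewrite -xy; have -> : nc_derive f x x = seg_derive f x by rewrite /nc_derive eqxx.
  have h := seg_derive_cvg df sx.
  apply: cvg_trans h; apply: near_eq_cvg; near=> z.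
  have [sz zx] : seg z /\ z != x by near: z; exact: near_within_seg.
  by rewrite /nc_derive eq_sym (negbTE zx).
have -> : nc_derive f x y = diff_quotient f x y by rewrite /nc_derive (negbTE xy).
have h : diff_quotient f x z @[z --> within seg (nbhs y)] --> diff_quotient f x y.
  apply: cvgM.
    apply: cvgB; first exact: cvg_cst.
    by have /seg_contP := seg_derivable_seg_cont df; exact.
  apply: cvgV; first by rewrite subr_eq0.
  apply: cvgB; first exact: cvg_cst.
  by apply: cvg_within_filter; exact: cvg_id.
apply: cvg_trans (cvg_dnbhs_within_seg h); apply: near_eq_cvg.
have nx : nbhs y (fun z => z != x).
  apply/nbhs_ballP; exists `|x - y|; first by rewrite /= normr_gt0 subr_eq0.
  by move=> z; rewrite /ball /= distrC; apply: contraTneq => ->; rewrite ltxx.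
change (nbhs y (fun z => z != y -> seg z -> diff_quotient f x z = nc_derive f x z)).
by apply: filterS nx => z zx _ _; rewrite /nc_derive eq_sym (negbTE zx).
Unshelve. all: by end_near. Qed.

(** Near an interior point the restriction to the segment is void, so [seg_derive] is the ordinary
    derivative there. This gives access to integration by parts. *)
Lemma is_derive_seg f x : seg_derivable f -> -2 < x < 2 ->
  is_derive x 1 f (seg_derive f x).
Proof.
move=> df /andP[x1 x2].
have sx : seg x by apply/seg_itv/andP; split; exact: ltW.
suff h : h^-1 *: (f (h *: 1 + x) - f x) @[h --> 0^'] --> seg_derive f x.
  by apply: DeriveDef; [apply/cvg_ex; eexists; exact: h|exact: cvg_lim h].
have /cvgrPdist_le dq := seg_derive_cvg df sx.
apply/cvgrPdist_le => e e0.
have dqe : nbhs x (fun y => y != x -> seg y -> `|seg_derive f x - diff_quotient f x y| <= e).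
  exact: dq e e0.
move/nbhs_ballP : dqe => [d /= d0 dP].
near=> h.
have h0 : h != 0 by near: h; exact: nbhs_dnbhs_neq.
have hd : `|h| < d by near: h; apply: dnbhs0_lt.
have hx : `|h| < Num.min (2 - x) (x + 2).
  by near: h; apply: dnbhs0_lt; rewrite lt_min; apply/andP; split; lra.
move: hx; rewrite lt_min !ltr_norml => /andP[/andP[_ h2] /andP[h3 _]].
have := dP (h + x); rewrite /ball /= => /(_ _ _ _).
rewrite /diff_quotient [h *: _]mulr1.
have -> : h^-1 *: (f (h + x) - f x) = (f x - f (h + x)) / (x - (h + x)).
  rewrite /GRing.scale /= -opprB; have -> : x - (h + x) = - h by ring.
  by rewrite invrN !mulrN mulrC.
apply.
- by rewrite opprD addrA addrAC subrr sub0r normrN.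
- by rewrite -subr_eq0 addrK.
- by apply/seg_itv/andP; split; lra.
Unshelve. all: by end_near. Qed.

End smooth.

(** * Chebyshev expansion of smooth functions *)

Section chebyshev_expansion.
Context {R : realType}.
Implicit Types (f g : R -> R) (x : R).

(* The coefficient of [tcheb n] in the expansion of [f], for n > 0. *)
Definition chebc f n : R := arcint (fun x => f x * tcheb n x) / 2.

Lemma seg_cont_mul_tcheb f n : seg_cont f -> seg_cont (fun x => f x * tcheb n x).
Proof. by move=> cf; apply: seg_contM => //; exact: seg_cont_tcheb. Qed.
Hint Resolve seg_cont_mul_tcheb : core.

Lemma chebcB f g n : seg_cont f -> seg_cont g -> chebc (fun x => f x - g x) n = chebc f n - chebc g n.
Proof.
move=> cf cg; rewrite /chebc -mulrBl -arcintB; [|exact: seg_cont_mul_tcheb..].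
by congr (_ / _); apply: eq_arcint => x _; rewrite mulrBl.
Qed.

Lemma eq_chebc f g n : (forall x, seg x -> f x = g x) -> chebc f n = chebc g n.
Proof. by move=> fg; congr (_ / _); apply: eq_arcint => x sx; rewrite fg. Qed.

Lemma chebc_cst (c : R) n : chebc (fun=> c) n = c * (n == 0)%:R.
Proof.
by rewrite /chebc arcintZ ?arcint_tcheb; [field|exact: seg_cont_tcheb].
Qed.

Lemma chebc_bound f (C : R) n : seg_cont f -> (forall x, seg x -> `|f x| <= C) ->
  `|chebc f n| <= C.
Proof.
move=> cf fC; rewrite /chebc normrM normfV [`|2|]ger0_norm// ler_pdivrMr//.
apply: arcint_norm; first exact: seg_cont_mul_tcheb.
by move=> x sx; rewrite normrM ler_pM ?fC// tcheb_bound.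
Qed.

Lemma chebcX0 g : seg_cont g -> chebc (fun x => x * g x) 0 = 2 * chebc g 1.
Proof.
move=> cg; rewrite /chebc mulrA -arcintZ; last exact: seg_cont_mul_tcheb.
by congr (_ / _); apply: eq_arcint => x _; rewrite tcheb0 tcheb1; ring.
Qed.

Lemma chebcXS g n : seg_cont g ->
  chebc (fun x => x * g x) n.+1 = chebc g n.+2 + chebc g n.
Proof.
move=> cg; rewrite /chebc -mulrDl -arcintD; [|exact: seg_cont_mul_tcheb..].
by congr (_ / _); apply: eq_arcint => x _; rewrite tchebSS; ring.
Qed.

(** Integration by parts in the angle: the boundary terms carry [sin ((n + 1) t)], which vanishes at
    0 and [pi], and [2 sin t sin ((n + 1) t) = cos (n t) - cos ((n + 2) t)]. *)
Lemma chebc_derive f n : seg_smooth f ->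
  n.+1%:R * chebc f n.+1 = chebc (seg_derive f) n - chebc (seg_derive f) n.+2.
Proof.
move=> sf; have pi0 := pi_gt0 R.
have cf := seg_cont_smooth sf.
have cf' : seg_cont (seg_derive f) by apply/seg_cont_smooth/seg_smooth_derive.
have df := seg_smooth_derivable sf.
rewrite /chebc -mulrBl mulrA; congr (_ / _); rewrite -arcintB; [|exact: seg_cont_mul_tcheb..].
rewrite !arcint_cos; last 2 first.
- by apply: seg_contB; exact: seg_cont_mul_tcheb.
- by apply: seg_cont_mul_tcheb.
have n1 : n.+1%:R != 0 :> R by rewrite pnatr_eq0.
pose F (t : R) := f (2 * cos t) / pi.
pose F' (t : R) := - (2 * sin t) * seg_derive f (2 * cos t) / pi.
pose G (t : R) := 2 * sin (n.+1%:R * t) / n.+1%:R.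
pose g (t : R) := 2 * cos (n.+1%:R * t).
have cF : continuous F by move=> t; apply: cvgM; [exact: seg_cont_comp_cos|exact: cvg_cst].
have cG : continuous G.
  move=> t; apply: cvgM; last exact: cvg_cst.
  by apply: cvgM; [exact: cvg_cst|exact: continuous_sinM].
have cF' : continuous F'.
  move=> t; apply: cvgM; last exact: cvg_cst.
  apply: cvgM; last exact: seg_cont_comp_cos.
  by apply: cvgN; apply: cvgM; [exact: cvg_cst|exact: continuous_sin].
have dG (t : R) : is_derive t 1 G (g t).
  have d := is_derive_sinM n.+1%:R t.
  apply: is_derive_eq; rewrite /GRing.scale /= /g !mulr0 !add0r.
  by rewrite ?mul0r ?addr0; field.
(* Only interior angles are allowed: at 0 and [pi] the point [2 cos t] is an endpoint, where [f] has
   just a one-sided derivative. *)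
have dF (t : R) : t \in `]0, pi[ -> is_derive t 1 F (F' t).
  rewrite in_itv /= => /andP[t0 t1].
  have dc : is_derive t 1 (fun t : R => 2 * cos t) (- (2 * sin t)).
    by apply: is_derive_eq; rewrite /GRing.scale /=; ring.
  have c2 : -2 < 2 * cos t < 2.
    have h1 : cos t < cos 0 by rewrite ltr_cos// in_itv /= ?lexx ?ltW.
    have h2 : cos pi < cos t by rewrite ltr_cos// in_itv /= ?lexx ?ltW.
    by move: h1 h2; rewrite cos0 cospi => h1 h2; apply/andP; split; lra.
  have df2 := is_derive_seg df c2.
  have d := @is_derive1_comp _ f (fun t => 2 * cos t) t _ _ df2 dc.
  apply: is_derive_eq; rewrite /GRing.scale /= /F' !mulr0 ?add0r ?mul0r ?addr0.
  by rewrite mulrC [_ * - _]mulrC.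
have IBP := @Rintegration_by_parts R F G F' g 0 pi pi0.
have -> : \int[lebesgue_measure]_(t in `[0, pi]) (f (2 * cos t) * tcheb n.+1 (2 * cos t) / pi) =
   \int[lebesgue_measure]_(t in `[0, pi]) (F t * g t) :> R.
  by apply: eq_Rintegral => t _; rewrite tcheb_cos /F /g mulrAC.
rewrite {}IBP.
- have -> : G pi = 0 by rewrite /G sin_natpi mulr0 mul0r.
  have -> : G 0 = 0 by rewrite /G mulr0 sin0 mulr0 mul0r.
  rewrite !mulr0 subrr sub0r mulrN.
  have cfG : lebesgue_measure.-integrable `[0, pi] (EFin \o (fun t => F' t * G t)).
    apply: continuous_compact_integrable; first exact: segment_compact.
    by apply: continuous_subspaceT => t; apply: cvgM; [exact: cF'|exact: cG].
  rewrite -mulNr -RintegralZl//; apply: eq_Rintegral => t _.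
  rewrite /F' -/(G t) /G !tcheb_cos.
  have -> : n.+2%:R * t = n.+1%:R * t + t by rewrite -[n.+2]addn1 natrD; ring.
  have -> : n%:R * t = n.+1%:R * t - t by rewrite -[n.+1]addn1 natrD; ring.
  rewrite [cos (_ - _)]cosB [cos (_ + _)]cosD.
  by move: (n.+1%:R : R) n1 (pi : R) pi0 => N N0 p p0; field; rewrite N0 gt_eqF.
- exact: continuous_subspaceT.
- split; first by move=> t t0; have := dF t t0 => ?; exact: ex_derive.
  + by apply: cvg_at_right_filter; exact: cF.
  + by apply: cvg_at_left_filter; exact: cF.
- by move=> t t0; rewrite derive1E; have := dF t t0 => ?; exact: derive_val.
- apply: continuous_subspaceT => t; apply: cvgM; first exact: cvg_cst.
  exact: continuous_cosM.
- split; first by move=> t t0; exact: ex_derive.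
  + by apply: cvg_at_right_filter; exact: cG.
  + by apply: cvg_at_left_filter; exact: cG.
- by move=> t t0; rewrite derive1E; exact: derive_val.
Qed.

(** By [chebc_derive], passing to the derivative gains one power of [n]; smoothness allows this any
    number of times, starting from the boundedness of a continuous function. *)
Lemma chebc_rapid f : seg_smooth f -> rapid (chebc f).
Proof.
move=> + r; elim: r f => [|r IH] f sf.
  have [_ [C fC]] := seg_cont_bounded_mfun (seg_cont_smooth sf).
  by exists C => n; rewrite expr0 mulr1; apply: chebc_bound => //; exact: seg_cont_smooth.
have [C hC] := IH _ (seg_smooth_derive sf).
(* The constant absorbs the shift from [n + 1] to [n + 2]: [(n + 2)^r <= 2^r (n + 1)^r] for the
   first coefficient, and [n + 2 <= 2 (n + 1)] for the extra power. Index 0, out of reach of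
   [chebc_derive], is handled by the maximum. *)
pose D := 2 * (2 ^+ r * C + C).
exists (Num.max (`|chebc f 0|) D) => -[|n].
  by rewrite expr1n mulr1 le_max lexx.
rewrite le_max; apply/orP; right.
have n1 : 0 < n.+1%:R :> R by [].
have n2 : 1 <= n.+1%:R :> R by rewrite ler1n.
rewrite -(ler_pM2l n1) mulrA -[n.+1%:R in X in X * _](@ger0_norm _ n.+1%:R)// -normrM.
rewrite chebc_derive//.
have e2 : n.+2%:R = n.+1%:R + 1 :> R by rewrite -natr1.
have h1 : `|chebc (seg_derive f) n| * n.+2%:R ^+ r <= 2 ^+ r * C.
  apply: (@le_trans _ _ (2 ^+ r * (`|chebc (seg_derive f) n| * n.+1%:R ^+ r))).
    rewrite mulrCA ler_wpM2l// -exprMn lerXn2r ?nnegrE ?mulr_ge0//.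
    by rewrite e2; lra.
  by rewrite ler_wpM2l ?exprn_ge0.
have h2 : `|chebc (seg_derive f) n.+2| * n.+2%:R ^+ r <= C.
  apply: le_trans (hC n.+2); rewrite ler_wpM2l// lerXn2r ?nnegrE//.
  by rewrite ler_nat.
rewrite exprS mulrA [X in X * _]mulrC -mulrA.
apply: (@le_trans _ _ (n.+2%:R * (2 ^+ r * C + C))).
  apply: ler_wpM2l => //; apply: le_trans (lerD h1 h2); rewrite -mulrDl.
  by apply: ler_wpM2r; [exact: exprn_ge0|exact: ler_normB].
rewrite /D mulrA ler_wpM2r//; last by rewrite e2; lra.
by apply: addr_ge0; [apply: le_trans h1|apply: le_trans h2]; rewrite mulr_ge0// exprn_ge0.
Qed.

(** Bessel's inequality: removing the component along [tcheb N.+1] lowers the squared norm of the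
    remainder [r N] by [2 c^2], where [c] is its coefficient. The squares are thus summable and the
    coefficients tend to 0. *)
Lemma chebc_cvg0 g : seg_cont g -> chebc g n @[n --> \oo] --> 0.
Proof.
move=> cg.
pose r N x := g x - \sum_(n < N) chebc g n.+1 * tcheb n.+1 x.
have cr N : seg_cont (r N).
  apply: seg_contB => //; apply: (@seg_cont_sum _ _ (fun n x => chebc g n.+1 * tcheb n.+1 x)) => i.
  by apply: seg_contZ; exact: seg_cont_tcheb.
have rS N x : r N.+1 x = r N x - chebc g N.+1 * tcheb N.+1 x.
  by rewrite /r big_ord_recr /=; ring.
(* The terms already subtracted are orthogonal to [tcheb n.+1] when [N <= n], so the remainder has
   the same coefficient there as [g]. *)
have rt N n : (N <= n)%N -> arcint (fun x => r N x * tcheb n.+1 x) = 2 * chebc g n.+1.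
  elim: N => [_|N IH Nn].
    rewrite mulrC divfK//; apply: eq_arcint => x _.
    by rewrite /r big_ord0 subr0.
  rewrite (@eq_arcint _ _ (fun x => r N x * tcheb n.+1 x - chebc g N.+1 * (tcheb N.+1 x * tcheb n.+1 x))).
    rewrite arcintB; [|exact: seg_cont_mul_tcheb|by apply: seg_contZ; apply: seg_cont_mul_tcheb; exact: seg_cont_tcheb].
    rewrite arcintZ; last by apply: seg_cont_mul_tcheb; exact: seg_cont_tcheb.
    by rewrite IH 1?ltnW// arcint_tchebM ltn_eqF// !mulr0 subr0.
  by move=> x _; rewrite rS; ring.
have rr N : arcint (fun x => r N.+1 x * r N.+1 x) = arcint (fun x => r N x * r N x) - 2 * chebc g N.+1 ^+ 2.
  rewrite (@eq_arcint _ _ (fun x => (r N x * r N x - (2 * chebc g N.+1) * (r N x * tcheb N.+1 x))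
      + chebc g N.+1 ^+ 2 * (tcheb N.+1 x * tcheb N.+1 x))); last first.
    by move=> x _; rewrite rS; ring.
  have c1 : seg_cont (fun x => tcheb N.+1 x * tcheb N.+1 x : R).
    by apply: seg_cont_mul_tcheb; exact: seg_cont_tcheb.
  rewrite arcintD; [|apply: seg_contB; [exact: seg_contM|by apply: seg_contZ; exact: seg_cont_mul_tcheb]|exact: seg_contZ].
  rewrite arcintB; [|exact: seg_contM|by apply: seg_contZ; exact: seg_cont_mul_tcheb].
  have -> : arcint (fun x => 2 * chebc g N.+1 * (r N x * tcheb N.+1 x)) =
    2 * chebc g N.+1 * arcint (fun x => r N x * tcheb N.+1 x) by apply: arcintZ; exact: seg_cont_mul_tcheb.
  have -> : arcint (fun x => chebc g N.+1 ^+ 2 * (tcheb N.+1 x * tcheb N.+1 x)) =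
    chebc g N.+1 ^+ 2 * arcint (fun x => tcheb N.+1 x * tcheb N.+1 x) by exact: arcintZ.
  by rewrite rt// arcint_tchebM eqxx mulr1; ring.
have bessel N : \sum_(n < N) (2 * chebc g n.+1 ^+ 2) <= arcint (fun x => g x * g x).
  have -> : \sum_(n < N) (2 * chebc g n.+1 ^+ 2) = arcint (fun x => g x * g x) - arcint (fun x => r N x * r N x).
    elim: N => [|N IH].
      rewrite big_ord0 (@eq_arcint _ (fun x => r 0%N x * r 0%N x) (fun x => g x * g x)) ?subrr//.
      by move=> x _; rewrite /r big_ord0 subr0.
    by rewrite big_ord_recr /= IH rr; ring.
  by rewrite lerBlDr lerDl; apply: arcint_ge0 => x _; rewrite -expr2 sqr_ge0.
have cs : cvgn (series (fun n => 2 * chebc g n.+1 ^+ 2)).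
  apply: nondecreasing_is_cvgn.
    by apply: nondecreasing_series => n _ _; rewrite mulr_ge0// sqr_ge0.
  exists (arcint (fun x => g x * g x)) => _ [N _ <-]; rewrite seriesEord; exact: bessel.
rewrite -(cvg_shiftn 1).
move/cvg_series_cvg_0/cvgrPdist_lt : cs => cs; apply/cvgrPdist_lt => e e0.
have e20 : 0 < 2 * e ^+ 2 by rewrite mulr_gt0// exprn_gt0.
have := cs _ e20; apply: filterS => n.
rewrite /= addn1 !sub0r !normrN => h.
have {h} : 2 * chebc g n.+1 ^+ 2 < 2 * e ^+ 2 by apply: le_lt_trans h; exact: ler_norm.
by rewrite ltr_pM2l// -(real_normK (num_real (chebc g n.+1))) ltr_sqr// nnegrE ltW.
Qed.

(** Multiplication by the variable acts on coefficients and on the [tcheb] by the same three-term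
    recurrence. Writing [f(y) = f(x) + (y - x) g(y)] therefore makes the partial sums telescope, up
    to one boundary term. *)
Lemma chebc_christoffel f x N : seg_derivable f -> seg x ->
  let g := nc_derive f x in
  chebc f 0 + \sum_(n < N) chebc f n.+1 * tcheb n.+1 x =
  f x + (chebc g N.+1 * tcheb N x - chebc g N * tcheb N.+1 x).
Proof.
move=> df sx g.
have cf := seg_derivable_seg_cont df.
have cg : seg_cont g := seg_cont_nc_derive df sx.
have cxg : seg_cont (fun y => y * g y) by apply: seg_contM => //; exact: seg_cont_id.
have fE y : f y = f x + (y * g y - x * g y).
  by rewrite -mulrBl -[X in _ + X]opprK -mulNr opprB -nc_deriveE; ring.
have fnE n : chebc f n = f x * (n == 0)%:R + (chebc (fun y => y * g y) n - x * chebc g n).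
  rewrite (@eq_chebc f (fun y => (y * g y - x * g y) - (- f x))); last by move=> y _; rewrite fE; ring.
  rewrite chebcB; [|by apply: seg_contB => //; exact: seg_contZ|exact: seg_cont_cst].
  rewrite chebcB//; last exact: seg_contZ.
  rewrite chebc_cst.
  have -> : chebc (fun x0 => x * g x0) n = x * chebc g n.
    rewrite /chebc mulrA -arcintZ; last exact: seg_cont_mul_tcheb.
    by congr (_ / _); apply: eq_arcint => y _; rewrite mulrA.
  ring.
elim: N => [|N IH].
  by rewrite big_ord0 fnE chebcX0// tcheb0 tcheb1 mulr1; ring.
rewrite big_ord_recr /= addrA IH [chebc f _]fnE chebcXS// tchebSS /=; ring.
Qed.

Lemma cvg_bounded_mul0 (u v : R ^nat) (C : R) :
  (forall n, `|v n| <= C) -> u @ \oo --> 0 -> u n * v n @[n --> \oo] --> 0.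
Proof.
move=> vC /cvgr0Pnorm_le u0; apply/cvgr0Pnorm_le => e e0.
have C0 : 0 < `|C| + 1 by rewrite ltr_pwDr.
have := u0 (e / (`|C| + 1)) (divr_gt0 e0 C0); apply: filterS => n un.
rewrite normrM; apply: (@le_trans _ _ (e / (`|C| + 1) * (`|C| + 1))).
  rewrite ler_pM// (le_trans (vC n))// (le_trans (ler_norm _))// lerDl//.
by rewrite divfK// gt_eqF.
Qed.

(** The boundary term of [chebc_christoffel] tends to 0, since the coefficients of [g] do and the
    [tcheb] are bounded by 2 on the segment. *)
Lemma tcheb_expansion f x : seg_derivable f -> seg x ->
  series (fun n => chebc f n.+1 * tcheb n.+1 x) @ \oo --> f x - chebc f 0.
Proof.
move=> df sx; pose g := nc_derive f x.
have cg0 : chebc g n @[n --> \oo] --> 0.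
  by apply: chebc_cvg0; exact: seg_cont_nc_derive.
have -> : series (fun n => chebc f n.+1 * tcheb n.+1 x) = (fun N =>
  (f x - chebc f 0) + (chebc g N.+1 * tcheb N x - chebc g N * tcheb N.+1 x)).
  apply/funext => N; rewrite seriesEord.
  by have /= := chebc_christoffel N df sx; rewrite -/g => h; lra.
rewrite -[X in _ --> X]addr0; apply: cvgD; first exact: cvg_cst.
rewrite -[X in _ --> X](subrr 0); apply: cvgB.
  apply: (@cvg_bounded_mul0 (fun N => chebc g N.+1) (fun N => tcheb N x) 2).
    by move=> n; exact: tcheb_bound.
  by rewrite -(cvg_shiftn 1) in cg0; move: cg0; under eq_fun do rewrite addn1.
apply: (@cvg_bounded_mul0 (chebc g) (fun N => tcheb N.+1 x) 2) => //.
by move=> n; exact: tcheb_bound.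
Qed.

(* [seg_derive f] is the sum of the [psib f n * psi n]. *)
Definition psib f n : R := n.+1%:R * chebc f n.+1.

Lemma psib_rapid f : seg_smooth f -> rapid (psib f).
Proof.
move=> sf; apply: (@rapid_le _ (fun n => chebc f n.+1) _ 1 1).
  by move=> n; rewrite /psib mul1r expr1 normrM normr_nat mulrC.
exact/rapidS/chebc_rapid.
Qed.

(** The expansion of [seg_derive f] in the [tcheb] is rearranged, rather than that of [f]
    differentiated: [psib f n] is a difference of coefficients of [seg_derive f] by [chebc_derive],
    and [tcheb n.+2 = psi n.+2 - psi n]. *)
Lemma psi_expansion f x : seg_smooth f -> seg x ->
  series (fun n => psib f n * psi n x) @ \oo --> seg_derive f x.
Proof.
move=> sf sx; have sf' := seg_smooth_derive sf.
set f' := seg_derive f in sf' *.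
have ha := tcheb_expansion (seg_smooth_derivable sf') sx.
have hb := rapid_cvg0 1 (chebc_rapid sf').
rewrite -(cvg_shiftn 2).
(* Summation by parts with step 2 leaves two boundary terms. Rapid decay of the coefficients beats
   the linear growth of [psi] and sends them to 0. *)
have hs N : series (fun n => psib f n * psi n x) N.+2 =
   chebc f' 0 + series (fun n => chebc f' n.+1 * tcheb n.+1 x) N.+1
   - (chebc f' N.+2 * psi N x + chebc f' N.+3 * psi N.+1 x).
  rewrite !seriesEord /=; elim: N => [|N IH].
    rewrite !big_ord_recr !big_ord0 /= /psib !chebc_derive// -/f' psi0 psi1 tcheb1; ring.
  rewrite big_ord_recr /= IH [in RHS]big_ord_recr /= /psib chebc_derive// -/f'.
  by rewrite (tcheb_psi N) ; ring.
have -> : (fun n => series (fun n => psib f n * psi n x) (n + 2)%N) =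
  (fun N => chebc f' 0 + series (fun n => chebc f' n.+1 * tcheb n.+1 x) N.+1
   - (chebc f' N.+2 * psi N x + chebc f' N.+3 * psi N.+1 x)).
  by apply/funext => n; rewrite addn2 hs.
have hh (u : R ^nat) (l : R) : u @ \oo --> l -> (fun n => u n.+1) @ \oo --> l.
  by rewrite -(cvg_shiftn 1) => h; move: h; under eq_fun do rewrite addn1.
have hpsi k : chebc f' (N + k).+2 * psi (N + k) x @[N --> \oo] --> 0.
  move: hb; rewrite -(cvg_shiftn k.+2) => /cvgr0Pnorm_le hb; apply/cvgr0Pnorm_le => e e0.
  have := hb e e0; apply: filterS => n; apply: le_trans.
  rewrite /= !addnS expr1 !normrM ler_wpM2l// normr_nat.
  by apply: (le_trans (psi_bound _ sx)); rewrite ler_nat; lia.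
rewrite (_ : f' x = chebc f' 0 + (f' x - chebc f' 0) - (0 + 0)); last by ring.
apply: cvgB; last apply: cvgD.
- by apply: cvgD; [exact: cvg_cst|exact: hh].
- by have := hpsi 0%N; under eq_fun do rewrite addn0.
- by have := hpsi 1%N; under eq_fun do rewrite addn1.
Qed.

End chebyshev_expansion.

(** * The operator N *)

Section operator_N.
Context {R : realType}.
Implicit Types (f g : R -> R) (x : R).

Lemma arcint_diff_quotient f x : seg_derivable f -> seg x ->
  arcint (diff_quotient f x) = arcint (nc_derive f x).
Proof.
move=> df sx; have cg := seg_cont_nc_derive df sx.
have mg := seg_cont_measurable cg.
rewrite /arcint /Rintegral; congr fine.
(* The two functions differ only at [y = x], where [diff_quotient] is 0 because [0 / 0 = 0]. The
   explicit correction shows measurability; a point is null for the arcsine law. *)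
have dq y : diff_quotient f x y = nc_derive f x y - nc_derive f x x * \1_[set x] y.
  rewrite indicE; have [->|yx] := eqVneq y x.
    by rewrite mem_set//= mulr1 subrr /diff_quotient subrr mul0r.
  rewrite memNset/= ?mulr0 ?subr0; last by move=> /eqP; rewrite (negbTE yx).
  by rewrite /nc_derive eq_sym (negbTE yx).
apply: ae_eq_integral.
- exact: measurable_seg.
- apply/measurable_EFinP.
  have -> : diff_quotient f x = (fun y => nc_derive f x y - nc_derive f x x * \1_[set x] y).
    exact/funext/dq.
  apply: measurable_funB => //; apply: measurable_funM => //.
- exact/measurable_EFinP.
exists [set x]; split=> //.
  exact: (@integral_set1 R (fun y => (arcsine_pdf y)%:E) x).
move=> y /= /not_implyP[_]; rewrite dq => h; apply: contrapT => yx; apply: h.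
by rewrite indicE memNset// mulr0 subr0.
Qed.

Lemma arcint_series f (u : nat -> R -> R) (M : R ^nat) g : seg_cont g ->
  (forall n, seg_cont (u n)) -> (forall n x, seg x -> `|u n x| <= M n) ->
  cvgn (series M) -> (forall x, seg x -> series (u ^~ x) @ \oo --> f x) ->
  series (fun n => arcint (fun x => g x * u n x)) @ \oo --> arcint (fun x => g x * f x).
Proof.
move=> cg cu uM cM uf; apply: (@Rintegral_series _ _ _ (arcsine R) _ _ g u f M) => //.
- exact: measurable_seg.
- exact: seg_cont_integrable.
- by move=> n; exact: seg_cont_measurable.
Qed.

(** The mean of [psi n] is 1 for even [n] and 0 for odd [n], which the three facts below encode. *)
Let E n : R := arcint (psi n).

Let E0 : E 0 = 1.
Proof. by rewrite -arcint1; apply: eq_arcint => x _; rewrite psi0. Qed.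

Let E1 : E 1 = 0.
Proof. by rewrite -(arcint_tchebS 0); apply: eq_arcint => x _; rewrite psi1. Qed.

Let ESS n : E n.+2 = E n.
Proof.
apply/eqP; rewrite -subr_eq0 /E -arcintB; [|exact: seg_cont_psi..].
by rewrite -(arcint_tchebS n.+1); apply/eqP/eq_arcint => x _; rewrite tcheb_psi.
Qed.

Let arcint_id_psi n : arcint (fun y => y * psi n y) = 2 * E n.+1.
Proof.
case: n => [|n].
  by rewrite E1 mulr0 -E1; apply: eq_arcint => y _; rewrite psi0 psi1 mulr1.
rewrite (@eq_arcint _ _ (fun y => psi n.+2 y + psi n y)); last by move=> y _; rewrite psiSS; ring.
by rewrite arcintD; [|exact: seg_cont_psi..]; rewrite -!/(E _) ESS; ring.
Qed.

(** The arcsine mean over [y] of the divided difference of [psi n] between [x] and [y], which by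
    [csum_divdiff] is [csum n.-1 [:: x; y]], or 0 when [n = 0]. *)
Let kappa n x : R := if n is n'.+1 then arcint (fun y => csum n' [:: x; y]) else 0.

Lemma seg_cont_csum2 n x : seg_cont (fun y => csum n [:: x; y] : R).
Proof. by apply: continuous_seg_cont; exact: continuous_csum2. Qed.

Let kappaSS n x : kappa n.+2 x = x * kappa n.+1 x - kappa n x + E n.+1.
Proof.
case: n => [|n] /=.
  rewrite subr0 (@eq_arcint _ _ (fun y => x * csum 0 [:: x; y] + psi 1 y)).
    rewrite arcintD; [|by apply: seg_contZ; exact: seg_cont_csum2|exact: seg_cont_psi].
    by rewrite arcintZ//; exact: seg_cont_csum2.
  by move=> y _; rewrite csum_consS csum1 csum0 mulr1.
rewrite (@eq_arcint _ _ (fun y => x * csum n.+1 [:: x; y] - csum n [:: x; y] + psi n.+2 y)).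
  rewrite arcintD; [|by apply: seg_contB; [apply: seg_contZ|]; exact: seg_cont_csum2|exact: seg_cont_psi].
  rewrite arcintB; [|by apply: seg_contZ; exact: seg_cont_csum2|exact: seg_cont_csum2].
  by rewrite arcintZ//; exact: seg_cont_csum2.
by move=> y _; rewrite csum_consSS csum1.
Qed.

(** The left side is the formula of N with [psi n] as derivative. It satisfies the three-term
    recurrence of the [tcheb]: the extra mean in [kappaSS] is compensated by [ESS]. As [tcheb n.+1]
    has derivative [(n + 1) psi n], this is the eigenvalue relation for N. *)
Let Nop_psi n x :
  arcint (fun y => y * psi n y) + x * arcint (psi n) - (4 - x ^+ 2) * kappa n x = tcheb n.+1 x.
Proof.
rewrite arcint_id_psi -/(E n).
elim/two_step_ind: n => [||n IH0 IH1].
- by rewrite E0 E1 /= tcheb1; ring.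
- rewrite ESS E0 E1 /= (@eq_arcint _ _ (fun=> 1)); last by move=> y _; rewrite csum0.
  by rewrite arcint1 tchebSS tcheb1 tcheb0; ring.
- by rewrite tchebSS -IH0 -IH1 kappaSS !ESS; ring.
Qed.

Lemma Nop_series phi x : seg_smooth phi -> seg x ->
  series (fun n => psib phi n * tcheb n.+1 x) @ \oo --> Nop phi x.
Proof.
move=> sphi sx; have rb := psib_rapid sphi; set b := psib phi in rb *.
have sphi' := seg_smooth_derive sphi; set phi' := seg_derive phi in sphi' *.
have bphi y : seg y -> series (fun n => b n * psi n y) @ \oo --> phi' y.
  by move=> sy; exact: psi_expansion.
pose M n := `|b n| * n.+1%:R ^+ 1.
have cM : cvgn (series M) by exact: rapid_summable.
have bM n y : seg y -> `|b n * psi n y| <= M n.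
  by move=> sy; rewrite normrM ler_wpM2l// expr1 psi_bound.
have cb n : seg_cont (fun y => b n * psi n y) by apply: seg_contZ; exact: seg_cont_psi.
have h1 := arcint_series seg_cont_id cb bM cM bphi.
have h2 := arcint_series (@seg_cont_cst R 1) cb bM cM bphi.
pose u n y := b n.+1 * csum n [:: x; y].
pose M3 n := `|b n.+1| * n.+1%:R ^+ 4.
have cM3 : cvgn (series M3) by apply: (@rapid_summable _ (fun n => b n.+1)); exact: rapidS.
have cu n : seg_cont (u n) by apply: seg_contZ; exact: seg_cont_csum2.
have uM n y : seg y -> `|u n y| <= M3 n.
  move=> sy; rewrite normrM ler_wpM2l//.
  by apply: (@csum_bound _ n [:: x; y]) => /=; rewrite andbT; apply/andP; split; exact/asboolP.
have uphi y : seg y -> series (u ^~ y) @ \oo --> nc_derive phi' x y.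
  move=> sy; have := @nc_deriven_series _ phi' b 1 [:: x; y] rb bphi erefl.
  rewrite /= andbT => /(_ _) h; rewrite /u.
  have -> : (fun n => b n.+1 * csum n [:: x; y]) = (fun n => b (n + 1)%N * csum n [:: x; y]).
    by apply/funext => n; rewrite addn1.
  by apply: h; apply/andP; split; exact/asboolP.
have h3 := arcint_series (@seg_cont_cst R 1) cu uM cM3 uphi.
have -> : Nop phi x = arcint (fun y => y * phi' y) + x * arcint (fun y => 1 * phi' y)
    - (4 - x ^+ 2) * arcint (fun y => 1 * nc_derive phi' x y).
  rewrite /Nop -/phi' -!/(arcint _) arcint_diff_quotient//; last exact: seg_smooth_derivable.
  congr (_ + x * _ - _ * _).
    by apply: eq_arcint => y _; rewrite mul1r.
  by apply: eq_arcint => y _; rewrite mul1r.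
(* The divided difference kills the [psi 0] term, so its series has one term fewer: [N] terms there
   match [N + 1] terms in the two other series. *)
have hlim : (series (fun n => arcint (fun y => y * (b n * psi n y))) N.+1
   + x * series (fun n => arcint (fun y => 1 * (b n * psi n y))) N.+1
   - (4 - x ^+ 2) * series (fun n => arcint (fun y => 1 * u n y)) N) @[N --> \oo] -->
  arcint (fun y => y * phi' y) + x * arcint (fun y => 1 * phi' y)
    - (4 - x ^+ 2) * arcint (fun y => 1 * nc_derive phi' x y).
  have hh (v : R ^nat) (l : R) : v @ \oo --> l -> (fun n => v n.+1) @ \oo --> l.
    by rewrite -(cvg_shiftn 1) => h; move: h; under eq_fun do rewrite addn1.
  apply: cvgB; last by apply: cvgM => //; exact: cvg_cst.
  apply: cvgD; first exact: hh.
  by apply: cvgM; [exact: cvg_cst|exact: hh].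
rewrite -(cvg_shiftn 1); apply: cvg_trans hlim; apply: near_eq_cvg; apply: nearW => N /=.
rewrite addn1 !seriesEord /=.
have -> : (4 - x ^+ 2) * (\sum_(n < N) arcint (fun y => 1 * u n y)) =
   \sum_(n < N.+1) b n * ((4 - x ^+ 2) * kappa n x).
  rewrite big_ord_recl /= !mulr0 add0r mulr_sumr; apply: eq_bigr => i _.
  rewrite (@eq_arcint _ _ (fun y => b i.+1 * csum i [:: x; y])); last by move=> y _; rewrite mul1r.
  by rewrite arcintZ; [rewrite mulrCA|exact: seg_cont_csum2].
rewrite mulr_sumr -big_split /= -sumrB; apply: eq_bigr => i _.
rewrite -Nop_psi mulrBr; congr (_ - _); rewrite mulrDr; congr (_ + _).
  rewrite (@eq_arcint _ _ (fun y => b i * (y * psi i y))); last by move=> y _; rewrite mulrCA.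
  by rewrite arcintZ//; apply: seg_contM; [exact: seg_cont_id|exact: seg_cont_psi].
rewrite (@eq_arcint _ _ (fun y => b i * psi i y)); last by move=> y _; rewrite mul1r.
have -> : arcint (fun y => b i * psi i y) = b i * arcint (psi i) by apply: arcintZ; exact: seg_cont_psi.
exact: mulrCA.
Qed.

(** Integrating [phi] against [tcheb n.+1] gives [2 * chebc phi n.+1], that is
    [2 * psib phi n / (n + 1)]; the factor 2 is cancelled by the half. *)
Lemma beta_dot_Nop phi : seg_smooth phi ->
  series (fun n => psib phi n ^+ 2 / n.+1%:R) @ \oo --> (1 / 2 * beta_dot (Nop phi) phi : R).
Proof.
move=> sphi; have rb := psib_rapid sphi; have cphi := seg_cont_smooth sphi.
pose u n x := psib phi n * tcheb n.+1 x.
pose M : R ^nat := 2 *: (fun n => `|psib phi n| * n.+1%:R ^+ 0).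
have cM : cvgn (series M) by apply: is_cvg_seriesZ; exact: rapid_summable.
have uM n x : seg x -> `|u n x| <= M n.
  move=> sx; rewrite /u /M normrM -[leRHS]/(2 * (_ * _)) expr0 mulr1 mulrC.
  by rewrite ler_wpM2r// tcheb_bound.
have cu n : seg_cont (u n) by apply: seg_contZ; exact: seg_cont_tcheb.
have := arcint_series cphi cu uM cM (fun x sx => Nop_series sphi sx).
have -> : arcint (fun x => phi x * Nop phi x) = beta_dot (Nop phi) phi.
  by apply: eq_arcint => x _; rewrite mulrC.
have -> : (fun n => arcint (fun x => phi x * u n x)) = (fun n => 2 * (psib phi n ^+ 2 / n.+1%:R)).
  apply/funext => n; rewrite (@eq_arcint _ _ (fun x => psib phi n * (phi x * tcheb n.+1 x))).
    rewrite arcintZ; last exact: seg_cont_mul_tcheb.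
    have -> : arcint (fun x => phi x * tcheb n.+1 x) = 2 * chebc phi n.+1.
      by rewrite /chebc mulrC divfK.
    have n1 : n.+1%:R != 0 :> R by rewrite pnatr_eq0.
    by rewrite /psib; move: (n.+1%:R : R) n1 => N N0; field.
  by move=> x _; rewrite /u mulrCA.
move=> h; rewrite div1r.
have : 2^-1 * series (fun n => 2 * (psib phi n ^+ 2 / n.+1%:R)) N @[N --> \oo] -->
    2^-1 * beta_dot (Nop phi) phi by apply: cvgM => //; exact: cvg_cst.
apply: cvg_trans; apply: near_eq_cvg; apply: nearW => N.
by rewrite !seriesEord /= mulr_sumr; apply: eq_bigr => i _; rewrite mulKf.
Qed.

End operator_N.

(** * Integration over the cube *)

Section tuple_integral.
Context {R : realType}.
Local Notation T := (measurableTypeR R).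
Implicit Types (n m k : nat).

Definition tbehead k (t : k.+1.-tuple T) : k.-tuple T := [tuple of behead t].

Lemma measurable_cube k : measurable (@cube R k).
Proof.
have -> : @cube R k = \bigcap_(i in [set: 'I_k]) ((fun t => tnth t i) @^-1` (seg : set T)).
  by apply/seteqP; split=> t h i //; [move=> _|]; exact: h.
apply: fin_bigcap_measurable; first exact: finite_finset.
move=> i _; rewrite -[X in measurable X]setTI.
by apply: measurable_tnth => //; exact: measurable_seg.
Qed.
Hint Resolve measurable_cube : core.

Lemma cube_cons k (t : k.+1.-tuple T) : cube t <-> seg (thead t) /\ cube (tbehead t).
Proof.
split=> [h|[h0 h1] i].
  split; first exact: h.
  by move=> i; have := h (lift ord0 i); rewrite {1}(tuple_eta t) tnthS.
rewrite (tuple_eta t); case: (unliftP ord0 i) => [j ->|->]; last by rewrite tnth0.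
by rewrite tnthS; exact: h1.
Qed.

Lemma cube_all k (t : k.-tuple T) : cube t -> all (fun x => `[< seg x >]) t.
Proof.
move=> h; apply/allP => x /tnthP[i ->]; apply/asboolP; exact: h.
Qed.

Lemma alphan_cube_lty k : (alphan k (@cube R k) < +oo)%E.
Proof. exact: le_lt_trans (probability_le1 _ (@measurable_cube k)) (ltry _). Qed.
Hint Resolve alphan_cube_lty : core.

Lemma measurable_thead k : measurable_fun setT (fun t : k.+1.-tuple T => thead t).
Proof. exact: measurable_tnth. Qed.

Lemma bounded_mfun_tensor k (f : T -> R) (G : k.-tuple T -> R) :
  bounded_mfun (seg : set T) f -> bounded_mfun (@cube R k) G ->
  bounded_mfun (@cube R k.+1) (fun t => f (thead t) * G (tbehead t)).
Proof.
move=> [mf [M fM]] [mG [N GN]]; apply: bounded_mfunM; split.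
- apply: (@measurable_comp _ _ _ _ _ _ (seg : set T) f (@cube R k.+1) (fun t => thead t)) => //.
  + exact: measurable_seg.
  + by move=> _ /= [t /cube_cons[h _] <-].
  + by apply: measurable_funTS; exact: measurable_thead.
- by exists M => t /cube_cons[h _]; exact: fM.
- apply: (@measurable_comp _ _ _ _ _ _ (@cube R k) G (@cube R k.+1) (@tbehead k)) => //.
  + exact: measurable_cube.
  + by move=> _ /= [t ct <-]; exact: ((cube_cons t).1 ct).2.
  + by apply: measurable_funTS; exact: measurable_behead.
- by exists N => t /cube_cons[_ h]; exact: GN.
Qed.

(** The law of a tuple is the image of a product measure by [cons_pair]. A change of variables and
    Fubini split off the first coordinate, once both factors are extended by 0 outside of the
    segment and the cube. *)
Lemma Rintegral_tensor k (f : T -> R) (G : k.-tuple T -> R) :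
  bounded_mfun (seg : set T) f -> bounded_mfun (@cube R k) G ->
  \int[alphan k.+1]_(t in @cube R k.+1) (f (thead t) * G (tbehead t)) =
  \int[semicircle R]_(x in seg) f x * \int[alphan k]_(t in @cube R k) G t.
Proof.
move=> bf bG.
have [mf [M fM]] := bf; have [mG [N GN]] := bG.
pose f1 := f \_ seg; pose G1 := G \_ (@cube R k).
have mf1 : measurable_fun setT f1.
  by apply/(measurable_restrictT f) => //; exact: measurable_seg.
have mG1 : measurable_fun setT G1 by exact: (measurable_restrictT G (@measurable_cube k)).1.
rewrite Rintegral_mkcond.
have -> : (fun t : k.+1.-tuple T => f (thead t) * G (tbehead t)) \_ (@cube R k.+1) =
    (fun t => f1 (thead t) * G1 (tbehead t)).
  apply/funext => t; rewrite /f1 /G1 !patchE.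
  have [ct|ct] := pselect (cube t).
    by have [h1 h2] := (cube_cons t).1 ct; rewrite !mem_set.
  rewrite memNset//; have [h1|h1] := pselect (seg (thead t)); last first.
    by rewrite [thead t \in _]memNset// mul0r.
  rewrite [tbehead t \in _]memNset ?mulr0// => h2; apply: ct.
  by apply/cube_cons.
rewrite [\int[semicircle R]_(_ in _) _]Rintegral_mkcond -/f1.
rewrite [\int[alphan k]_(_ in _) _]Rintegral_mkcond -/G1.
have bf1 : bounded_mfun (setT : set T) f1.
  split => //; exists `|M| => x _; rewrite /f1 patchE; case: ifPn; rewrite ?normr0//.
  by rewrite inE => /fM h; apply: (le_trans h); exact: ler_norm.
have bG1 : bounded_mfun setT G1.
  split => //; exists `|N| => x _; rewrite /G1 patchE; case: ifPn; rewrite ?normr0//.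
  by rewrite inE => /GN h; apply: (le_trans h); exact: ler_norm.
pose P := semicircle R; pose Q := alphan k : probability _ R.
pose h (p : T * k.-tuple T) := (f1 p.1 * G1 p.2)%R.
have bh : bounded_mfun setT h.
  apply: bounded_mfunM; split.
  - exact: (measurableT_comp mf1).
  - by have [_ [C hC]] := bf1; exists C => p _; exact: hC.
  - exact: (measurableT_comp mG1).
  - by have [_ [C hC]] := bG1; exists C => p _; exact: hC.
have ih : (P \x Q)%E.-integrable setT (EFin \o h).
  apply: bounded_mfun_integrable => //.
  exact: le_lt_trans (probability_le1 _ measurableT) (ltry _).
have iG1 : Q.-integrable setT (EFin \o G1).
  apply: bounded_mfun_integrable => //.
  exact: le_lt_trans (probability_le1 _ measurableT) (ltry _).
have if1 : P.-integrable setT (EFin \o f1).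
  apply: bounded_mfun_integrable => //.
  exact: le_lt_trans (probability_le1 _ measurableT) (ltry _).
transitivity (fine (\int[(P \x Q)%E]_p (h p)%:E)).
  rewrite /Rintegral; congr fine.
  have hE : EFin \o h = (fun t => (f1 (thead t) * G1 (tbehead t))%:E) \o (@cons_pair _ T k).
    apply/funext => -[x t] /=; rewrite /h /=; congr (_ * G1 _)%:E.
    by apply/val_inj.
  rewrite -[LHS]/(\int[distribution (P \x Q)%E (@cons_pair _ T k)]_t (f1 (thead t) * G1 (tbehead t))%:E)%E.
  rewrite integral_pushforward//=.
  - by rewrite preimage_setT; apply: eq_integral => p _; rewrite -[RHS]/((EFin \o h) p) hE.
  - apply/measurable_EFinP; apply: measurable_funM.
      by apply: (measurableT_comp mf1); exact: measurable_thead.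
    by apply: (measurableT_comp mG1); exact: measurable_behead.
  - by rewrite preimage_setT; rewrite -hE.
rewrite -(integral12_prod_meas1 ih).
rewrite /fubini_F /=.
transitivity (fine (\int[P]_x (f1 x * (\int[Q]_t G1 t))%:E)).
  congr fine; apply: eq_integral => x _; rewrite /h /=.
  transitivity (\int[Q]_t ((f1 x)%:E * (EFin \o G1) t))%E.
    by apply: eq_integral => t _; rewrite /= EFinM.
  rewrite integralZl// EFinM; congr (_ * _)%E.
  by rewrite fineK//; exact: integrable_fin_num.
rewrite -[LHS]/(\int[P]_x (f1 x * \int[Q]_t G1 t)).
exact: RintegralZr.
Qed.

End tuple_integral.

(** * Scalar products of the [csum] and of the [psi_tensor] *)

Section csum_integral.
Context {R : realType}.
Local Notation T := (measurableTypeR R).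
Implicit Types (n m k : nat).

(** Under the arcsine law the weight [(4 - x^2) / 2] turns the product into half the difference of
    two [tcheb] by [psiM]; only [tcheb 0] has a nonzero mean, equal to 2. *)
Lemma psi_orthonormal n m :
  \int[semicircle R]_(x in seg) (psi n x * psi m x) = (n == m)%:R :> R.
Proof.
wlog nm : n m / (m <= n)%N.
  move=> H; have [|/ltnW] := leqP m n; first exact: H.
  by move=> /H; rewrite eq_sym => <-; apply: eq_Rintegral => x _; rewrite mulrC.
have cp : seg_cont (fun x => psi n x * psi m x : R) by apply: seg_contM; exact: seg_cont_psi.
rewrite Rintegral_semicircle; last exact: seg_cont_measurable.
rewrite -(subnKC nm); move: (n - m)%N => p.
rewrite -[LHS]/(arcint _) (@eq_arcint _ _ (fun x => 2^-1 * (tcheb p x - tcheb (m + p + m).+2 x))); last first.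
  by move=> x _; rewrite -psiM; ring.
rewrite arcintZ; last by apply: seg_contB; exact: seg_cont_tcheb.
rewrite arcintB; [|exact: seg_cont_tcheb..].
rewrite !arcint_tcheb mulr0 subr0 mulKf//; congr (_%:R).
by apply/eqP/eqP; lia.
Qed.

Lemma bounded_mfun_csum k n : bounded_mfun (@cube R k) (fun t => csum n t).
Proof.
elim: k n => [n|k IH n].
  have -> : (fun t : 0.-tuple T => csum n t : R) = (fun=> (n == 0%N)%:R).
    by apply/funext => t; rewrite tuple0 csum_nil.
  exact: bounded_mfun_cst.
have -> : (fun t : k.+1.-tuple T => csum n t : R) =
   (fun t => \sum_(j < n.+1) psi j (thead t) * csum (n - j) (tbehead t)).
  by apply/funext => t; rewrite {1}(tuple_eta t) csum_cons.
apply: (@bounded_mfun_sum _ _ _ _ _ (fun j t => psi j (thead t) * csum (n - j) (tbehead t))) => j.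
by apply: (@bounded_mfun_tensor _ _ (psi j) (fun t => csum (n - j) t)) => //; apply: seg_cont_bounded_mfun; exact: seg_cont_psi.
Qed.

Lemma psi_tensor_cons k (a : k.+1.-tuple nat) (t : k.+1.-tuple T) :
  psi_tensor a t = psi (thead a) (thead t) * psi_tensor [tuple of behead a] (tbehead t).
Proof.
rewrite /psi_tensor big_ord_recl; congr (_ * _); apply: eq_bigr => i _.
by rewrite {1}(tuple_eta a) {1}(tuple_eta t) !tnthS.
Qed.

Lemma psi_tensor_nil (a : 0.-tuple nat) (t : 0.-tuple T) : psi_tensor a t = 1.
Proof. by rewrite /psi_tensor big_ord0. Qed.

Lemma bounded_mfun_psi_tensor k (a : k.-tuple nat) : bounded_mfun (@cube R k) (psi_tensor a).
Proof.
elim: k a => [a|k IH a].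
  have -> : @psi_tensor R 0 a = (fun=> 1) by apply/funext => t; exact: psi_tensor_nil.
  exact: bounded_mfun_cst.
have -> : @psi_tensor R k.+1 a =
    (fun t => psi (thead a) (thead t) * psi_tensor [tuple of behead a] (tbehead t)).
  by apply/funext => t; exact: psi_tensor_cons.
by apply: bounded_mfun_tensor => //; apply: seg_cont_bounded_mfun; exact: seg_cont_psi.
Qed.

Lemma bounded_mfun_cube_integrable k (F : k.-tuple T -> R) :
  bounded_mfun (@cube R k) F -> (alphan k).-integrable (@cube R k) (EFin \o F).
Proof.
by move=> bF; apply: bounded_mfun_integrable => //; [exact: measurable_cube|exact: alphan_cube_lty].
Qed.

Lemma Rintegral_cube_sum k N (F : nat -> k.-tuple T -> R) : (forall i, bounded_mfun (@cube R k) (F i)) ->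
  \int[alphan k]_(t in @cube R k) (\sum_(i < N) F i t) =
  \sum_(i < N) \int[alphan k]_(t in @cube R k) F i t.
Proof.
move=> bF; elim: N => [|N IH].
  rewrite big_ord0; under eq_Rintegral do rewrite big_ord0.
  by rewrite Rintegral_cst ?mul0r//; exact: measurable_cube.
under eq_Rintegral do rewrite big_ord_recr /=.
rewrite RintegralD; last 2 first.
- by apply: bounded_mfun_cube_integrable; exact: bounded_mfun_sum.
- exact: bounded_mfun_cube_integrable.
- by rewrite IH big_ord_recr.
- exact: measurable_cube.
Qed.

Lemma alpha_dot_tensor k i j (F G : k.-tuple T -> R) :
  bounded_mfun (@cube R k) F -> bounded_mfun (@cube R k) G ->
  alpha_dot (fun t : k.+1.-tuple T => psi i (thead t) * F (tbehead t))
            (fun t => psi j (thead t) * G (tbehead t)) = (i == j)%:R * alpha_dot F G.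
Proof.
move=> bF bG; rewrite /alpha_dot -psi_orthonormal.
rewrite -Rintegral_tensor; last 2 first.
- by apply: seg_cont_bounded_mfun; apply: seg_contM; exact: seg_cont_psi.
- exact: bounded_mfunM.
by apply: eq_Rintegral => t _; rewrite mulrACA.
Qed.

Lemma alpha_dot0 (F G : 0.-tuple T -> R) : alpha_dot F G = F [tuple] * G [tuple].
Proof.
have cE : @cube R 0 = setT by apply/seteqP; split=> // t _ [].
rewrite /alpha_dot cE.
rewrite (@eq_Rintegral _ _ _ _ _ (fun=> F [tuple] * G [tuple])); last first.
  by move=> t _; rewrite tuple0.
rewrite Rintegral_cst; last exact: measurableT.
rewrite -[RHS]mulr1; congr (_ * _).
exact: (congr1 fine (probability_setT (alphan 0))).
Qed.

(** The [psi_a] are orthonormal, so the squared norm counts the multi-indices of length [k + 1] and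
    weight [n]. Splitting off the first index makes this a hockey-stick sum. *)
Lemma alpha_dot_csum k n m :
  alpha_dot (fun t : k.+1.-tuple T => csum n t) (fun t => csum m t) =
  (n == m)%:R * 'C(n + k, k)%:R.
Proof.
(* The count for every length, including 0, where only the empty multi-index of weight 0 exists; the
   induction can then start from the empty tuple. *)
pose D k n : R := if k is k'.+1 then 'C(n + k', k')%:R else (n == 0)%:R.
suff H k' n' m' : alpha_dot (fun t : k'.-tuple T => csum n' t) (fun t => csum m' t) =
  (n' == m')%:R * D k' n' by exact: H.
elim: k' n' m' => {k n m} [n m|k IH n m].
  by rewrite alpha_dot0 !csum_nil /=; case: n m => [|n] [|m]; rewrite ?mul0r ?mulr0.
pose P i (t : k.+1.-tuple T) := psi i (thead t) * csum (n - i) (tbehead t).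
pose Q i (t : k.+1.-tuple T) := psi i (thead t) * csum (m - i) (tbehead t).
have bP i : bounded_mfun (@cube R k.+1) (P i).
  apply: (@bounded_mfun_tensor _ _ (psi i) (fun t => csum (n - i) t)); last exact: bounded_mfun_csum.
  by apply: seg_cont_bounded_mfun; exact: seg_cont_psi.
have bQ i : bounded_mfun (@cube R k.+1) (Q i).
  apply: (@bounded_mfun_tensor _ _ (psi i) (fun t => csum (m - i) t)); last exact: bounded_mfun_csum.
  by apply: seg_cont_bounded_mfun; exact: seg_cont_psi.
have -> : alpha_dot (fun t : k.+1.-tuple T => csum n t) (fun t => csum m t) =
    \sum_(i < n.+1) \sum_(j < m.+1) alpha_dot (P i) (Q j).
  rewrite /alpha_dot.
  transitivity (\int[alphan k.+1]_(t in @cube R k.+1) (\sum_(i < n.+1) \sum_(j < m.+1) (P i t * Q j t))).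
    apply: eq_Rintegral => t _; rewrite (tuple_eta t) !csum_cons -(tuple_eta t).
    by rewrite mulr_suml; apply: eq_bigr => i _; rewrite mulr_sumr; apply: eq_bigr.
  rewrite (Rintegral_cube_sum _ (F := fun i t => \sum_(j < m.+1) (P i t * Q j t))).
    apply: eq_bigr => i _.
    by rewrite (Rintegral_cube_sum _ (F := fun j t => (P i t * Q j t)))// => j; exact: bounded_mfunM.
  by move=> i; apply: (@bounded_mfun_sum _ _ _ _ _ (fun j t => P i t * Q j t)) => j; exact: bounded_mfunM.
have PQ i j : alpha_dot (P i) (Q j) = (i == j)%:R * ((n - i == m - j)%N%:R * D k (n - i)%N).
  rewrite -IH; exact: (@alpha_dot_tensor k i j (fun t => csum (n - i) t) (fun t => csum (m - j) t)
     (@bounded_mfun_csum k _) (@bounded_mfun_csum k _)).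
have [nm|nm] := eqVneq n m; last first.
  rewrite mul0r big1// => i _; rewrite big1// => j _; rewrite PQ.
  have [ij|] := eqVneq (i : nat) j; last by rewrite mul0r.
  have : (n - i != m - j)%N.
    apply: contra nm => /eqP; move: (ltn_ord i) (ltn_ord j); rewrite ij => ? ? ?; apply/eqP; lia.
  by move/negbTE => ->; rewrite mul0r mulr0.
rewrite nm mul1r.
transitivity (\sum_(i < m.+1) D k (m - i)%N).
  apply: eq_bigr => i _; rewrite (bigD1 i)//= big1 ?addr0; last first.
    by move=> j; rewrite PQ -val_eqE eq_sym => /negbTE ->; rewrite mul0r.
  by rewrite PQ nm !eqxx !mul1r.
rewrite (reindex_inj rev_ord_inj) /=.
transitivity (\sum_(i < m.+1) D k i).
  by apply: eq_bigr => i _; rewrite subSS subKn// -ltnS ltn_ord.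
case: k {IH P Q bP bQ PQ nm} => [|k] /=.
  by rewrite big_ord_recl /= big1 ?addr0 ?bin0.
rewrite -natr_sum; congr (_%:R).
elim: m => [|m IHm]; first by rewrite big_ord1 !add0n !binn.
by rewrite big_ord_recr /= IHm [in RHS]addSn binS addSnnS.
Qed.

(** Each [psi_a] occurs exactly once in the [csum] of its own weight, and in no other. *)
Lemma alpha_dot_csum_psi k n (a : k.-tuple nat) :
  alpha_dot (fun t : k.-tuple T => csum n t) (psi_tensor a) =
  (n == \sum_(i < k) tnth a i)%N%:R.
Proof.
elim: k n a => [|k IH] n a.
  by rewrite alpha_dot0 csum_nil psi_tensor_nil mulr1 big_ord0.
pose P i (t : k.+1.-tuple T) := psi i (thead t) * csum (n - i) (tbehead t).
pose b := [tuple of behead a].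
pose Q (t : k.+1.-tuple T) := psi (thead a) (thead t) * psi_tensor b (tbehead t).
have bP i : bounded_mfun (@cube R k.+1) (P i).
  apply: (@bounded_mfun_tensor _ _ (psi i) (fun t => csum (n - i) t)); last exact: bounded_mfun_csum.
  by apply: seg_cont_bounded_mfun; exact: seg_cont_psi.
have bQ : bounded_mfun (@cube R k.+1) Q.
  by apply: bounded_mfun_tensor; [apply: seg_cont_bounded_mfun; exact: seg_cont_psi|exact: bounded_mfun_psi_tensor].
have -> : alpha_dot (fun t : k.+1.-tuple T => csum n t) (psi_tensor a) =
    \sum_(i < n.+1) alpha_dot (P i) Q.
  rewrite /alpha_dot -(Rintegral_cube_sum _ (F := fun i t => P i t * Q t)); last first.
    by move=> i; exact: bounded_mfunM.
  apply: eq_Rintegral => t _; rewrite psi_tensor_cons {1}(tuple_eta t) csum_cons.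
  by rewrite mulr_suml.
have PQ i : alpha_dot (P i) Q = (i == thead a)%:R * (n - i == \sum_(j < k) tnth b j)%N%:R.
  rewrite -IH; exact: (@alpha_dot_tensor k i (thead a) (fun t => csum (n - i) t) (psi_tensor b)
     (@bounded_mfun_csum k _) (bounded_mfun_psi_tensor _)).
have -> : (\sum_(i < k.+1) tnth a i = thead a + \sum_(j < k) tnth b j)%N.
  rewrite big_ord_recl; congr (_ + _)%N; apply: eq_bigr => i _.
  by rewrite {1}(tuple_eta a) tnthS.
move: (\sum_(j < k) tnth b j)%N PQ => B PQ.
under eq_bigr do rewrite PQ.
have [an|an] := ltnP (thead a) n.+1; last first.
  rewrite big1; last first.
    move=> i _; have := ltn_ord i => ?; rewrite (_ : (_ == thead a) = false) ?mul0r//.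
    by apply/negbTE/eqP; lia.
  by rewrite (_ : (n == _) = false)//; apply/negbTE/eqP; lia.
rewrite (bigD1 (Ordinal an))//= eqxx mul1r big1 ?addr0; last first.
  by move=> i; rewrite -val_eqE /= => /negbTE ->; rewrite mul0r.
by congr (_%:R); apply/eqP/eqP; lia.
Qed.

(** [M_graph] speaks only of the [psi_tensor a]. An explicit list of multi-indices, built by the
    value of the first index, transfers its equations to [csum]. *)
Lemma csum_psi_tensor k n : exists s : seq (k.-tuple nat),
  (forall a, a \in s -> \sum_(i < k) tnth a i = n)%N /\
  forall t : k.-tuple T, csum n t = \sum_(a <- s) psi_tensor a t.
Proof.
elim: k n => [|k IH] n.
  exists (if n == 0%N then [:: [tuple]] else [::]); split.
    by case: eqP => // -> a; rewrite big_ord0.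
  move=> t; rewrite tuple0 csum_nil; case: eqP => _; last by rewrite big_nil.
  by rewrite big_seq1 psi_tensor_nil.
suff H N : (N <= n.+1)%N -> exists s : seq (k.+1.-tuple nat),
    (forall a, a \in s -> \sum_(i < k.+1) tnth a i = n)%N /\
    forall t : k.+1.-tuple T,
      \sum_(j < N) psi j (thead t) * csum (n - j) (tbehead t) = \sum_(a <- s) psi_tensor a t.
  have [s [s1 s2]] := H n.+1 (leqnn _); exists s; split=> // t.
  by rewrite {1}(tuple_eta t) csum_cons -s2.
elim: N => [_|N IHN Nn].
  by exists [::]; split=> // t; rewrite big_ord0 big_nil.
have [s [s1 s2]] := IHN (ltnW Nn); have [s' [s'1 s'2]] := IH (n - N)%N.
exists (s ++ [seq cons_tuple N a | a <- s']); split.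
  move=> a; rewrite mem_cat => /orP[/s1//|/mapP[b /s'1 bs ->]].
  rewrite big_ord_recl tnth0; under eq_bigr do rewrite tnthS.
  by rewrite bs subnKC.
move=> t; rewrite big_ord_recr /= s2 big_cat /= big_map; congr (_ + _).
rewrite -[csum (n - N) _]/(csum (n - N) (tbehead t)) s'2 mulr_sumr; apply: eq_bigr => a _; rewrite psi_tensor_cons theadE.
by congr (_ * psi_tensor _ _); apply/val_inj.
Qed.

End csum_integral.

(** * The operator M *)

Section operator_M.
Context {R : realType}.
Local Notation T := (measurableTypeR R).
Implicit Types (n m k : nat) (c : R ^nat).

Lemma bounded_mfun_L2alpha k (F : k.-tuple T -> R) : bounded_mfun (@cube R k) F -> L2alpha F.
Proof.
move=> [mF [M FM]].
have mF1 : measurable_fun setT (F \_ (@cube R k)).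
  by exact: (measurable_restrictT F (@measurable_cube R k)).1.
have [C hC] : exists C, forall t, `|(F \_ (@cube R k)) t| <= C.
  exists `|M| => t; rewrite patchE; case: ifPn; rewrite ?normr0//.
  by rewrite inE => /FM h; apply: (le_trans h); exact: ler_norm.
rewrite /L2alpha inE /=; apply/andP; split; rewrite inE//=.
rewrite /finite_norm unlock poweR_lty//.
have bF : bounded_mfun setT (fun t => (F \_ (@cube R k)) t ^+ 2).
  split; first exact: measurable_funX.
  exists (C ^+ 2) => t _; rewrite normrX lerXn2r ?nnegrE//.
  exact: le_trans (hC t).
have iF : (alphan k).-integrable setT (EFin \o (fun t => (F \_ (@cube R k)) t ^+ 2)).
  apply: bounded_mfun_integrable => //; exact: le_lt_trans (probability_le1 _ measurableT) (ltry _).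
have := integrable_lty measurableT iF; apply: le_lt_trans.
rewrite le_eqVlt; apply/orP; left; apply/eqP; apply: eq_integral => t _ /=.
by rewrite powR_mulrn// real_normK// num_real.
Qed.

Lemma L2alpha_integrable k (F : k.-tuple T -> R) : L2alpha F ->
  (alphan k).-integrable (@cube R k) (EFin \o F).
Proof.
move=> h; have afin : alphan k (setT : set (k.-tuple T)) \is a fin_num.
  by rewrite ge0_fin_numE ?measure_ge0//; exact: le_lt_trans (probability_le1 _ measurableT) (ltry _).
have /Lfun1_integrable := Lfun_subset12 afin h.
by rewrite -restrict_EFin => /(integrable_mkcond _ (@measurable_cube R k)).2.
Qed.

Lemma alpha_dotC k (F G : k.-tuple T -> R) : alpha_dot F G = alpha_dot G F.
Proof. by apply: eq_Rintegral => t _; rewrite mulrC. Qed.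

Lemma csum_tuple_bound k n (t : k.-tuple T) : cube t -> `|csum n t| <= n.+1%:R ^+ (2 * k).
Proof. by move=> ct; have := csum_bound n (cube_all ct); rewrite size_tuple. Qed.

Section sum_of_csum.
Variables (k : nat) (c : R ^nat) (F : k.-tuple T -> R).
Hypotheses (rc : rapid c)
  (cF : forall t, cube t -> series (fun n => c n * csum n t) @ \oo --> F t).

Let M n := `|c n| * n.+1%:R ^+ (2 * k).

Let cM : cvgn (series M).
Proof. exact: rapid_summable. Qed.

Let mc n : measurable_fun (@cube R k) (fun t => c n * csum n t).
Proof. by have [] := bounded_mfunZ (c n) (@bounded_mfun_csum R k n). Qed.

Let bM n t : (@cube R k) t -> `|c n * csum n t| <= M n.
Proof. by move=> ct; rewrite normrM ler_wpM2l// csum_tuple_bound. Qed.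

Lemma bounded_mfun_csum_series : bounded_mfun (@cube R k) F.
Proof. exact: (bounded_mfun_series mc bM cM cF). Qed.

Lemma alpha_dot_series G : (alphan k).-integrable (@cube R k) (EFin \o G) ->
  series (fun n => c n * alpha_dot G (fun t => csum n t)) @ \oo --> alpha_dot G F.
Proof.
move=> iG; have := @Rintegral_series _ _ _ (alphan k) _ (@measurable_cube R k) _ _ _ M iG mc bM cM cF.
apply: cvg_trans; rewrite (_ : (fun n => c n * _) =
   (fun n => \int[alphan k]_(t in @cube R k) (G t * (c n * csum n t))))//.
apply/funext => n; rewrite /alpha_dot -RintegralZl; last first.
- exact: (integrable_bounded_mfun (@measurable_cube R k) iG (@bounded_mfun_csum R k n)).
- exact: measurable_cube.
- by apply: eq_Rintegral => t _; rewrite mulrCA.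
Qed.

Let series_delta (n : nat) (D : R) :
  series (fun j => c j * ((j == n)%:R * D)) @ \oo --> c n * D.
Proof.
apply: cvg_near_cst; exists n.+1 => // N /= nN; apply/eqP.
rewrite seriesEord /= (bigD1 (Ordinal nN))//= eqxx mul1r big1 ?addr0//.
by move=> i; rewrite -val_eqE /= => /negbTE ->; rewrite mul0r mulr0.
Qed.

Lemma alpha_dot_series_psi (a : k.-tuple nat) :
  alpha_dot F (psi_tensor a) = c (\sum_(i < k) tnth a i)%N.
Proof.
rewrite alpha_dotC.
have h := alpha_dot_series (bounded_mfun_cube_integrable (bounded_mfun_psi_tensor a)).
have h2 := @series_delta (\sum_(i < k) tnth a i)%N 1.
rewrite mulr1 in h2; apply: (cvg_unique _ h) => //.
apply: cvg_trans h2; rewrite (_ : (fun j => c j * (_ * 1)) =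
  (fun n => c n * alpha_dot (psi_tensor a) (fun t => csum n t)))//.
by apply/funext => n; rewrite alpha_dotC alpha_dot_csum_psi mulr1.
Qed.

End sum_of_csum.

Lemma alpha_dot_series_csum m c (F : m.+1.-tuple T -> R) n : rapid c ->
  (forall t, cube t -> series (fun n => c n * csum n t) @ \oo --> F t) ->
  alpha_dot F (fun t => csum n t) = c n * 'C(n + m, m)%:R.
Proof.
move=> rc cF; rewrite alpha_dotC.
have h := alpha_dot_series rc cF (bounded_mfun_cube_integrable (@bounded_mfun_csum R m.+1 n)).
have h2 : series (fun j => c j * ((j == n)%:R * 'C(n + m, m)%:R)) @ \oo --> c n * 'C(n + m, m)%:R.
  apply: cvg_near_cst; exists n.+1 => // N /= nN; apply/eqP.
  rewrite seriesEord /= (bigD1 (Ordinal nN))//= eqxx mul1r big1 ?addr0//.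
  by move=> i; rewrite -val_eqE /= => /negbTE ->; rewrite mul0r mulr0.
apply: (cvg_unique _ h) => //.
apply: cvg_trans h2; rewrite (_ : (fun j => c j * (_ * _)) =
  (fun j => c j * alpha_dot (fun t : m.+1.-tuple T => csum n t) (fun t => csum j t)))//.
by apply/funext => j; rewrite alpha_dot_csum eq_sym.
Qed.

Lemma rapid_csum_cvg k c (t : k.-tuple T) : rapid c -> cube t ->
  cvgn (series (fun n => c n * csum n t)).
Proof.
move=> rc ct; apply: (@series_abs_cvg _ _ (fun n => `|c n| * n.+1%:R ^+ (2 * k))).
  by move=> n; rewrite normrM ler_wpM2l// csum_tuple_bound.
exact: rapid_summable.
Qed.

(** All the [psi_a] in [csum n] have eigenvalue [n], so summing the equations of [M_graph] over them
    gives the same equation for [csum n]. *)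
Lemma M_graph_csum k n (F G : k.-tuple T -> R) : M_graph F G ->
  alpha_dot G (fun t => csum n t) = n%:R * alpha_dot F (fun t => csum n t).
Proof.
move=> [LF LG FG]; have [s [s1 s2]] := @csum_psi_tensor R k n.
have iF := L2alpha_integrable LF; have iG := L2alpha_integrable LG.
have E (H : k.-tuple T -> R) : (alphan k).-integrable (@cube R k) (EFin \o H) ->
    alpha_dot H (fun t => csum n t) = \sum_(a <- s) alpha_dot H (psi_tensor a).
  move=> iH; rewrite /alpha_dot.
  transitivity (\int[alphan k]_(t in @cube R k) (\sum_(a <- s) H t * psi_tensor a t)).
    by apply: eq_Rintegral => t _; rewrite s2 mulr_sumr.
  clear s1 s2.
  have mcube := @measurable_cube R k.
  have I1 a : (alphan k).-integrable (@cube R k) (EFin \o (fun t => H t * psi_tensor a t)).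
    by apply: integrable_bounded_mfun => //; exact: bounded_mfun_psi_tensor.
  have [//] : (alphan k).-integrable (@cube R k) (EFin \o (fun t => \sum_(a <- s) H t * psi_tensor a t)) /\
    \int[alphan k]_(t in @cube R k) (\sum_(a <- s) H t * psi_tensor a t) =
     \sum_(a <- s) \int[alphan k]_(t in @cube R k) (H t * psi_tensor a t).
  elim: s => [|a s [IHi IH]].
    split.
      rewrite (_ : EFin \o _ = cst 0%E); first exact: integrable0.
      by apply/funext => t /=; rewrite big_nil.
    rewrite big_nil; under eq_Rintegral do rewrite big_nil.
    by rewrite Rintegral_cst ?mul0r.
  split.
    rewrite (_ : EFin \o _ = ((EFin \o (fun t => H t * psi_tensor a t)%R) \+
       (EFin \o (fun t => \sum_(a <- s) H t * psi_tensor a t)%R))%E).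
      exact: integrableD.
    by apply/funext => t /=; rewrite big_cons.
  rewrite big_cons -IH -RintegralD//.
  by apply: eq_Rintegral => t _; rewrite big_cons.
rewrite !E// mulr_sumr; apply: eq_big_seq => a /s1 an.
by rewrite FG an.
Qed.

(* Only the coordinates of [Mop] and [Mresolvent] along the [psi_tensor a]     *)
(* matter, and these are prescribed by [M_graph].                             *)
Lemma alpha_dot_Mop_Mresolvent m c (F : m.+1.-tuple T -> R) : rapid c ->
  (forall t, cube t -> series (fun n => c n * csum n t) @ \oo --> F t) ->
  series (fun n => c n ^+ 2 * (n%:R / (n + m.+1)%:R) * 'C(n + m, m)%:R) @ \oo -->
  alpha_dot (Mop (Mresolvent m.+1%:R F)) F.
Proof.
move=> rc cF.
have nm0 n : (n + m.+1)%:R != 0 :> R by rewrite pnatr_eq0; lia.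
(* The coefficients solve [n u_n + (m + 1) u_n = c_n]. The resulting pair [U], [V] shows that the
   sets from which [xget] chooses are inhabited. *)
pose u n := c n / (n + m.+1)%:R.
pose v n := n%:R * u n.
have ru : rapid u.
  apply: (@rapid_le _ c _ 1 0) => // n; rewrite mul1r expr0 mulr1 /u normrM normfV normr_nat.
  by rewrite ler_pdivrMr ?ltr0n; [rewrite ler_peMr// ler1n; lia|lia].
have rv : rapid v.
  apply: (@rapid_le _ u _ 1 1) => // n; rewrite mul1r expr1 /v normrM normr_nat mulrC.
  by rewrite ler_wpM2l// ler_nat.
pose U (t : m.+1.-tuple T) := limn (series (fun n => u n * csum n t)).
pose V (t : m.+1.-tuple T) := limn (series (fun n => v n * csum n t)).
have cU t : cube t -> series (fun n => u n * csum n t) @ \oo --> U t by exact: rapid_csum_cvg.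
have cV t : cube t -> series (fun n => v n * csum n t) @ \oo --> V t by exact: rapid_csum_cvg.
have gUV : M_graph U V.
  split.
  - exact/bounded_mfun_L2alpha/(bounded_mfun_csum_series ru cU).
  - exact/bounded_mfun_L2alpha/(bounded_mfun_csum_series rv cV).
  - move=> a; rewrite (alpha_dot_series_psi rv cV) (alpha_dot_series_psi ru cU); exact: erefl.
have VUF t : cube t -> V t + m.+1%:R * U t = F t.
  move=> ct; have h : series (fun n => v n * csum n t) N + m.+1%:R * series (fun n => u n * csum n t) N
     @[N --> \oo] --> V t + m.+1%:R * U t.
    by apply: cvgD; [exact: cV|apply: cvgM; [exact: cvg_cst|exact: cU]].
  apply: (cvg_unique _ h) => //; apply: cvg_trans (cF t ct).
  apply: near_eq_cvg; apply: nearW => N.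
  rewrite !seriesEord /= mulr_sumr -big_split /=; apply: eq_bigr => i _.
  rewrite mulrA -mulrDl; congr (_ * _); rewrite /v -mulrDl -natrD /u mulrC divfK//.
set U' := Mresolvent m.+1%:R F.
(* The chosen resolvent [U'] is only known to satisfy its specification, almost everywhere; it is
   not compared with [U]. *)
have [V' gV' aeV'] : exists2 V', M_graph U' V' &
    {ae alphan m.+1, forall t, cube t -> V' t + m.+1%:R * U' t = F t}.
  apply: (@xgetPex (m.+1.-tuple T -> R) (fun=> 0) [set U | exists2 V, M_graph U V &
    {ae alphan m.+1, forall t, cube t -> V t + m.+1%:R * U t = F t}]).
  by exists U; exists V => //; apply: aeW.
have gG : M_graph U' (Mop U').
  by apply: (@xgetPex (m.+1.-tuple T -> R) (fun=> 0) [set G | M_graph U' G]); exists V'.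
have [LU' LV' _] := gV'; have [_ LG _] := gG.
have iU' := L2alpha_integrable LU'; have iV' := L2alpha_integrable LV'.
have mcube := @measurable_cube R m.+1.
(* Pairing the resolvent equation with [csum n] turns M into multiplication by [n], which determines
   the pairing of [U'] since [n + m + 1] is not 0. *)
have key n : (n + m.+1)%:R * alpha_dot U' (fun t => csum n t) = c n * 'C(n + m, m)%:R.
  rewrite -(alpha_dot_series_csum n rc cF) natrD mulrDl -(M_graph_csum n gV').
  have bn := @bounded_mfun_csum R m.+1 n.
  have I1 := integrable_bounded_mfun mcube iV' bn; have I2 := integrable_bounded_mfun mcube iU' bn.
  rewrite /alpha_dot -RintegralZl// -RintegralD//; last first.
    exact: (integrableZl mcube m.+1%:R I2).
  rewrite /Rintegral; congr fine; apply: ae_eq_integral => //.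
  - apply/measurable_EFinP; apply: measurable_funD.
      by have /measurable_int/measurable_EFinP := I1.
    apply: measurable_funM => //.
    by have /measurable_int/measurable_EFinP := I2.
  - apply/measurable_EFinP.
    have [mF _] := bounded_mfunM (bounded_mfun_csum_series rc cF) bn; exact: mF.
  - apply: filterS aeV' => t h ct; congr EFin; rewrite -h//; ring.
(* Expanding [F] rather than [Mop U'] suffices: the latter is integrable, being in L^2, and its
   pairings with the [csum n] are known. *)
have := alpha_dot_series rc cF (L2alpha_integrable LG).
apply: cvg_trans; rewrite (_ : (fun n => c n ^+ 2 * _ * _) =
  (fun n => c n * alpha_dot (Mop U') (fun t => csum n t)))//.
apply/funext => n; rewrite (M_graph_csum n gG).
have -> : alpha_dot U' (fun t => csum n t) = c n * 'C(n + m, m)%:R / (n + m.+1)%:R.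
  by rewrite -key mulrC mulKf.
by rewrite expr2; ring.
Qed.

Lemma alpha_norm_series m c (F : m.+1.-tuple T -> R) : rapid c ->
  (forall t, cube t -> series (fun n => c n * csum n t) @ \oo --> F t) ->
  series (fun n => c n ^+ 2 * 'C(n + m, m)%:R) @ \oo --> alpha_norm F ^+ 2.
Proof.
move=> rc cF; rewrite /alpha_norm sqr_sqrtr; last first.
  by apply: Rintegral_ge0 => t _; rewrite -expr2 sqr_ge0.
have := alpha_dot_series rc cF (bounded_mfun_cube_integrable (bounded_mfun_csum_series rc cF)).
apply: cvg_trans; rewrite (_ : (fun n => c n ^+ 2 * _) =
  (fun n => c n * alpha_dot F (fun t => csum n t)))//.
by apply/funext => n; rewrite (alpha_dot_series_csum n rc cF) mulrA expr2.
Qed.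

End operator_M.

(** * Proof of the theorem *)

Section polynomials.
Context {R : realType}.
Implicit Types (f : R -> R) (n m k : nat).

(** By [chebcXS], multiplication by the variable moves coefficients by one index only, so the degree
    bounds the indices that can be reached. *)
Lemma chebc_exp j n : (j < n)%N -> chebc (fun x : R => x ^+ j) n = 0.
Proof.
elim: j n => [|j IH] [|n]// jn.
  rewrite (@eq_chebc _ _ (fun=> 1)); last by move=> x _; rewrite expr0.
  by rewrite chebc_cst mulr0.
rewrite (@eq_chebc _ _ (fun x => x * x ^+ j)); last by move=> x _; rewrite exprS.
rewrite chebcXS; last by apply: continuous_seg_cont; exact: exprn_continuous.
by rewrite !IH ?addr0//; lia.
Qed.

Lemma chebc_poly (p : {poly R}) n : (size p <= n)%N -> chebc (horner p) n = 0.
Proof.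
move=> pn; rewrite /chebc (@eq_arcint _ _ (fun x => \sum_(i < size p) p`_i * (x ^+ i * tcheb n x))).
  suff H N : (N <= n)%N -> arcint (fun x : R => \sum_(i < N) p`_i * (x ^+ i * tcheb n x)) = 0.
    by rewrite H// mul0r.
  have cx i : seg_cont (fun x : R => x ^+ i * tcheb n x).
    by apply: seg_cont_mul_tcheb; apply: continuous_seg_cont; exact: exprn_continuous.
  elim: N => [_|N IHN Nn].
    rewrite (@eq_arcint _ _ (fun=> 0 * 1)); last by move=> x _; rewrite big_ord0 mul0r.
    by rewrite arcintZ ?mul0r//; exact: seg_cont_cst.
  rewrite (@eq_arcint _ _ (fun x => \sum_(i < N) p`_i * (x ^+ i * tcheb n x) + p`_N * (x ^+ N * tcheb n x))).
    rewrite arcintD; [|apply: (@seg_cont_sum _ _ (fun i x => p`_i * (x ^+ i * tcheb n x))) => i; exact: seg_contZ|exact: seg_contZ].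
    rewrite IHN 1?ltnW// add0r arcintZ//.
    have := chebc_exp Nn; rewrite /chebc => /eqP; rewrite mulf_eq0 invr_eq0 pnatr_eq0 orbF => /eqP ->.
    by rewrite mulr0.
  by move=> x _; rewrite big_ord_recr.
by move=> x _; rewrite horner_coef mulr_suml; apply: eq_bigr => i _; rewrite mulrA.
Qed.

Fixpoint tchebp n : {poly R} :=
  match n with
  | 0 => 2%:P
  | 1 => 'X
  | (m.+1 as n').+1 => 'X * tchebp n' - tchebp m
  end.

Lemma tchebpE n x : (tchebp n).[x] = tcheb n x.
Proof.
elim/two_step_ind: n => [||n IH0 IH1].
- by rewrite /= hornerC.
- by rewrite /= hornerX.
- by rewrite -[tchebp n.+2]/('X * tchebp n.+1 - tchebp n) hornerD hornerN hornerM hornerX IH0 IH1.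
Qed.

Lemma size_tchebp n : (size (tchebp n) <= n.+1)%N.
Proof.
elim/two_step_ind: n => [||n IH0 IH1].
- exact: size_polyC_leq1.
- by rewrite size_polyX.
- rewrite -[tchebp n.+2]/('X * tchebp n.+1 - tchebp n).
  apply: (leq_trans (size_polyD _ _)); rewrite geq_max size_polyN; apply/andP; split.
    by apply: (leq_trans (size_polyMleq _ _)); rewrite size_polyX.
  by apply: (leq_trans IH0); lia.
Qed.

(** A polynomial has no coefficients beyond its degree; conversely, if these vanish,
    [tcheb_expansion] is a finite sum. The index is shifted, as [psib f n] carries the coefficient
    of [tcheb n.+1]. *)
Lemma seg_polyP k f : seg_smooth f ->
  seg_poly k f <-> forall n, (k <= n)%N -> psib f n = 0.
Proof.
move=> sf; split=> [[p sp fp] n kn|b0].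
  rewrite /psib (@eq_chebc _ _ (horner p))// chebc_poly ?mulr0//; lia.
have c0 n : (k <= n)%N -> chebc f n.+1 = 0.
  by move=> /b0/eqP; rewrite /psib mulf_eq0 pnatr_eq0 => /eqP.
exists ((chebc f 0)%:P + \sum_(i < k) chebc f i.+1 *: tchebp i.+1).
  apply: (leq_trans (size_polyD _ _)); rewrite geq_max; apply/andP; split.
    by apply: leq_trans (size_polyC_leq1 _) _.
  apply: (leq_trans (size_sum _ _ _)); apply/bigmax_leqP => i _.
  apply: (leq_trans (size_scale_leq _ _)); apply: (leq_trans (size_tchebp _)).
  by rewrite !ltnS.
move=> x sx; have h := tcheb_expansion (seg_smooth_derivable sf) sx.
rewrite hornerD hornerC horner_sum.
have h2 : series (fun n => chebc f n.+1 * tcheb n.+1 x) @ \oo --> \sum_(i < k) chebc f i.+1 * tcheb i.+1 x.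
  apply: cvg_near_cst; exists k => // N /= kN; apply/eqP; rewrite /series /=.
  rewrite (big_cat_nat _ kN)//= [X in _ + X]big_nat_cond [X in _ + X]big1 ?addr0 ?big_mkord//.
  by move=> i; rewrite andbT => /andP[ki _]; rewrite c0// mul0r.
have E : f x - chebc f 0 = \sum_(i < k) chebc f i.+1 * tcheb i.+1 x.
  exact: cvg_unique h h2.
rewrite -[f x](subrK (chebc f 0)) E addrC.
by congr (_ + _); apply: eq_bigr => i _; rewrite hornerZ tchebpE.
Qed.

End polynomials.

(** * The binomial identity and the comparison of series *)

Section main.
Context {R : realType}.

(** By Pascal's rule, the new summand for [k + 1] exactly compensates the change of the correction
    term, so the value does not depend on [k]. *)
Lemma alternating_binomial n k : (0 < k)%N ->
  \sum_(1 <= l < k.+1) (-1) ^+ l.-1 * 'C(n.+1, l)%:R + (-1) ^+ k * 'C(n, k)%:R = 1 :> R.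
Proof.
elim: k => // -[_ _|k IH _].
  by rewrite big_nat1 /= bin1 expr0 mul1r expr1 bin1 -natr1; ring.
rewrite big_nat_recr//= -[RHS](IH isT) -addrA; congr (_ + _).
by rewrite binS natrD !exprS; ring.
Qed.

(** It extracts the common factor [1 / (n + 1)], after which the sum over [l] is that of
    [alternating_binomial]. *)
Lemma mul_bin_succ n l : 'C(n, l)%:R / l.+1%:R = 'C(n.+1, l.+1)%:R / n.+1%:R :> R.
Proof.
have l1 : l.+1%:R != 0 :> R by rewrite pnatr_eq0.
have n1 : n.+1%:R != 0 :> R by rewrite pnatr_eq0.
apply/eqP; rewrite eqr_div// -!natrM; apply/eqP; congr (_%:R).
by rewrite mulnC (mul_bin_diag n.+1 l) mulnC.
Qed.


Lemma series_shift (v : R ^nat) p (l : R) : (forall n, (n < p)%N -> v n = 0) ->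
  series (fun n => v (n + p)%N) @ \oo --> l -> series v @ \oo --> l.
Proof.
move=> v0 h; rewrite -(cvg_shiftn p); apply: cvg_trans h.
apply: near_eq_cvg; apply: nearW => N; rewrite /series /=.
rewrite [RHS](big_cat_nat _ (leq_addl N p))//= [X in X + _]big_nat_cond [X in X + _]big1 ?add0r.
  by rewrite (_ : \sum_(p <= i < N + p) v i = \sum_(0 + p <= i < N + p) v i)// big_addn addnK.
by move=> i; rewrite andbT => /v0.
Qed.

Lemma nonneg_series_eq0 (v : R ^nat) : (forall n, 0 <= v n) ->
  series v @ \oo --> (0 : R) -> forall n, v n = 0.
Proof.
move=> v0 h n.
have nd : nondecreasing_seq (series v).
  by apply/nondecreasing_seqP => i; rewrite seriesSr lerDl.
have le0 N : series v N <= 0.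
  rewrite -(cvg_lim _ h)//; apply: nondecreasing_cvgn_le => //.
  by apply/cvg_ex; exists 0.
apply/eqP; rewrite eq_le v0 andbT; apply: le_trans (le0 n.+1).
rewrite seriesSr lerDr seriesEord; exact: sumr_ge0.
Qed.

End main.

Theorem theorem8 (R : realType) (k : nat) (k_gt0 : (0 < k)%N)
    (phi : R -> R) (phi_smooth : seg_smooth phi) :
  let phi' : R -> R := seg_derive phi in
  let d (l : nat) : l.-tuple (measurableTypeR R) -> R :=
    fun t => nc_deriven l.-1 phi' t in
  (1 / 2 * beta_dot (Nop phi) phi =
     \sum_(1 <= l < k.+1) (-1) ^+ l.-1 / l%:R * alpha_norm (d l) ^+ 2
     + (-1) ^+ k / k%:R
       * alpha_dot (Mop (Mresolvent k%:R (d k))) (d k))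
  /\
  (seg_poly k phi <->
   1 / 2 * beta_dot (Nop phi) phi =
     \sum_(1 <= l < k.+1) (-1) ^+ l.-1 / l%:R * alpha_norm (d l) ^+ 2).
Proof.
move=> phi' d; case: k k_gt0 => // m _.
pose b := psib phi; have rb : rapid b := psib_rapid phi_smooth.
have bphi x : seg x -> series (fun n => b n * psi n x) @ \oo --> phi' x.
  by move=> sx; exact: psi_expansion.
have rbs p : rapid (fun n => b (n + p)%N) by exact: rapid_shift.
have hd p (t : p.+1.-tuple (measurableTypeR R)) : cube t ->
    series (fun n => b (n + p)%N * csum n t) @ \oo --> d p.+1 t.
  by move=> ct; apply: nc_deriven_series => //; [exact: size_tuple|exact: cube_all].
(* All series are indexed by the same [j], the index of [b]. The binomial coefficient vanishes for
   [j < p], so [series_shift] restores the terms lost by differentiation. *)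
pose v p j := b j ^+ 2 * 'C(j, p)%:R.
have hv p : series (v p) @ \oo --> alpha_norm (d p.+1) ^+ 2.
  apply: (@series_shift _ _ p); first by move=> n np; rewrite /v bin_small// mulr0.
  exact: alpha_norm_series (rbs p) (hd p).
(* With [j = n + m], the weight [n / (n + m + 1) * 'C(n + m, m)] of the resolvent term becomes
   [(m + 1) * 'C(j, m + 1) / (j + 1)]; the factor [m + 1] will cancel the [1 / k] of the
   statement. *)
pose w j := b j ^+ 2 * (m.+1%:R * 'C(j, m.+1)%:R / j.+1%:R).
pose MT := alpha_dot (Mop (Mresolvent m.+1%:R (d m.+1))) (d m.+1).
have hw : series w @ \oo --> MT.
  apply: (@series_shift _ _ m).
    by move=> n nm; rewrite /w bin_small ?mulr0 ?mul0r ?mulr0//; lia.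
  have := alpha_dot_Mop_Mresolvent (rbs m) (hd m).
  rewrite (_ : (fun n => b (n + m)%N ^+ 2 * _ * _) = (fun n => w (n + m)%N))//.
  apply/funext => n; rewrite /w -natrM mul_bin_left addnK natrM addnS; ring.
have k0 : m.+1%:R != 0 :> R by rewrite pnatr_eq0.
have termE j : b j ^+ 2 / j.+1%:R =
    \sum_(i < m.+1) (-1) ^+ i / i.+1%:R * v i j + (-1) ^+ m.+1 / m.+1%:R * w j.
  have j0 : j.+1%:R != 0 :> R by rewrite pnatr_eq0.
  transitivity (b j ^+ 2 / j.+1%:R * (\sum_(1 <= l < m.+2) (-1) ^+ l.-1 * 'C(j.+1, l)%:R
      + (-1) ^+ m.+1 * 'C(j, m.+1)%:R)).
    by rewrite alternating_binomial// mulr1.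
  rewrite mulrDr; congr (_ + _).
    rewrite big_add1 /= big_mkord mulr_sumr; apply: eq_bigr => i _.
    transitivity ((-1) ^+ i * b j ^+ 2 * ('C(j.+1, i.+1)%:R / j.+1%:R)); first by rewrite /=; ring.
    by rewrite -mul_bin_succ /v; ring.
  by rewrite /w; move: (m.+1%:R : R) k0 (j.+1%:R : R) j0 => K K0 J J0; field; rewrite K0 J0.
have main : 1 / 2 * beta_dot (Nop phi) phi =
    \sum_(1 <= l < m.+2) (-1) ^+ l.-1 / l%:R * alpha_norm (d l) ^+ 2
    + (-1) ^+ m.+1 / m.+1%:R * MT.
  rewrite big_add1 /= big_mkord.
  have h := beta_dot_Nop phi_smooth; rewrite -/b in h.
  apply: (cvg_unique _ h) => //.
  have : \sum_(i < m.+1) (-1) ^+ i / i.+1%:R * series (v i) N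
      + (-1) ^+ m.+1 / m.+1%:R * series w N @[N --> \oo] -->
      \sum_(i < m.+1) (-1) ^+ i / i.+1%:R * alpha_norm (d i.+1) ^+ 2
      + (-1) ^+ m.+1 / m.+1%:R * MT.
    apply: cvgD; last by apply: cvgM => //; exact: cvg_cst.
    apply: (@cvg_sum_fun _ _ _ _ _ (fun i N => (-1) ^+ i / i.+1%:R * series (v i) N)
      (fun i => (-1) ^+ i / i.+1%:R * alpha_norm (d i.+1) ^+ 2)) => i.
    by apply: cvgM => //; exact: cvg_cst.
  apply: cvg_trans; apply: near_eq_cvg; apply: nearW => N.
  rewrite /series /= [RHS](eq_bigr _ (fun i _ => termE i)) big_split /= exchange_big /=.
  by rewrite mulr_sumr; congr (_ + _); apply: eq_bigr => i _; rewrite mulr_sumr.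
split; first exact: main.
have c0 : (-1) ^+ m.+1 / m.+1%:R != 0 :> R by rewrite mulf_neq0 ?invr_eq0// signr_eq0.
rewrite {}main; apply: (iff_trans (seg_polyP _ phi_smooth)); rewrite -/b.
(* The coefficient of [MT] is not 0, so by the identity just proved equality holds iff [MT = 0]. *)
transitivity (MT = 0); last first.
  split=> [->|/eqP]; first by rewrite mulr0 addr0.
  by rewrite -subr_eq0 addrC addKr mulf_eq0 (negbTE c0) => /eqP.
split=> [b0|MT0].
  have w0 : w = (fun=> 0).
    apply/funext => j; rewrite /w; have [mj|jm] := leqP m.+1 j.
      by rewrite b0// expr0n mul0r.
    by rewrite bin_small// mulr0 mul0r mulr0.
  apply: (cvg_unique _ hw) => //; rewrite w0.
  rewrite (_ : series _ = (fun=> 0)); first exact: cvg_cst.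
  by apply/funext => N; rewrite /series /= big1.
rewrite MT0 in hw; move=> n mn.
(* A series of nonnegative terms with sum 0 has only zero terms. For [n >= m + 1] the binomial
   factor of [w n] is positive, which forces [b n = 0]. *)
have w_ge0 j : 0 <= w j by rewrite mulr_ge0 ?sqr_ge0// divr_ge0// mulr_ge0.
have /eqP := nonneg_series_eq0 w_ge0 hw n.
rewrite /w mulf_eq0 sqrf_eq0 => /orP[/eqP//|].
by rewrite !mulf_eq0 invr_eq0 !pnatr_eq0 /= orbF -leqn0 leqNgt bin_gt0 mn.
Qed.
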